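(* Let $\dot A$ be a densely defined closed symmetric operator with deficiency indices $(1,1)$ in a Hilbert space $\mathcal H$, let $\mathcal H_+\subset\mathcal H\subset\mathcal H_-$ be the rigged Hilbert space generated by $\dot A$, let $g_\pm\in\operatorname{Ker}(\dot A^*\mp iI)$ be $(+)$-normalized deficiency vectors, $\|g_\pm\|_+=1$, and set $\varphi=\mathcal R^{-1}g_+$, $\psi=\mathcal R^{-1}g_-$, where $\mathcal R$ is the Riesz-Berezansky operator. Suppose that $A$ is the self-adjoint extension of $\dot A$ such that $g_+-g_-\in\mathrm{Dom}(A)$, and let $M_{(\dot A,A)}(z)$ be the Weyl-Titchmarsh function of the pair $(\dot A,A)$. Let $0<a<1$. Then the function $aM_{(\dot A,A)}(z)$ coincides with the impedance function of a unique L-system of the form $$\Theta_{1a}=\begin{pmatrix}\mathbb A_{1a}&K_{1a}&1\\ \mathcal H_+\subset\mathcal H\subset\mathcal H_-&&\mathbb C\end{pmatrix},$$ where $$\mathbb A_{1a}=\dot A^*-\tfrac i2\big(\cdot,(1-a)\varphi+(1+a)\psi\big)(\varphi-\psi),\qquad K_{1a}c=c\cdot\chi_{1a}\ (c\in\mathbb C),\qquad \chi_{1a}=\sqrt{\tfrac a2}\,(\varphi-\psi).$$ In this case the von Neumann parameter $\kappa$ of the main operator $T_{1a}$ of $\Theta_{1a}$ and the von Neumann parameter $U$ of the quasi-kernel $\hat A_{1a}=A$ of $\mathrm{Re}\,\mathbb A_{1a}$ are $$\kappa=\frac{1-a}{1+a}\quad\text{and}\quad U=-1.$$ Moreover, if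 $\Theta$ is an L-system with state-space operator $\mathbb A$, main operator $T$ and symmetric operator $\dot A$ such that $V_\Theta(z)=aM_{(\dot A,A)}(z)$ for $z\in\mathbb C_+$, where $A=\hat A$ is the quasi-kernel of $\mathrm{Re}\,\mathbb A$, then the von Neumann parameters $\kappa$ of $T$ and $U$ of $\hat A$ are $\kappa=\frac{1-a}{1+a}$ and $U=-1$.
   Context: Inner products are linear in the first argument. $\mathbb C_\pm$ are the open upper and lower half-planes. Rigged space. For a closed densely defined symmetric $\dot A$ in $\mathcal H$, $\mathcal H_+=\mathrm{Dom}(\dot A^* )$ with $(f,g)_+=(f,g)+(\dot A^*f,\dot A^*g)$, and $\mathcal H_-$ is the corresponding negative space (dual of $\mathcal H_+$ with respect to the pairing extending the inner product of $\mathcal H$, also written $(\cdot,\cdot)$), so $\mathcal H_+\subset\mathcal H\subset\mathcal H_-$. The Riesz-Berezansky operator $\mathcal R$ is the isometric (linear) map of $\mathcal H_-$ onto $\mathcal H_+$ with $(f,g)=(f,\mathcal Rg)_+$ for $f\in\mathcal H_+$, $g\in\mathcal H_-$. $[\mathcal H_1,\mathcal H_2]$ denotes bounded linear operators. For $\mathbb A\in[\mathcal H_+,\mathcal H_-]$ the adjoint $\mathbb A^*\in[\mathcal H_+,\mathcal H_-]$ is taken with respect to the pairing; $\mathrm{Re}\,\mathbb A=\frac12(\mathbb A+\mathbb A^* )$, $\mathrm{Im}\,\mathbb A=\frac1{2i}(\mathbb A-\mathbb A^* )$. For $u,v\in\mathcal H_-$, $(\cdot,u)v$ denotes the operator $f\mapsto(f,u)v$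 from $\mathcal H_+$ to $\mathcal H_-$. Extensions. A quasi-self-adjoint extension of $\dot A$ is a non-symmetric operator $T$ in $\mathcal H$ with $\dot A\subset T\subset\dot A^*$. A self-adjoint bi-extension of $\dot A$ is $\mathbb B\in[\mathcal H_+,\mathcal H_-]$ with $\dot A\subset\mathbb B=\mathbb B^*$; its quasi-kernel is the restriction of $\mathbb B$ to $\{f\in\mathcal H_+:\mathbb Bf\in\mathcal H\}$; it is t-self-adjoint if its quasi-kernel is self-adjoint in $\mathcal H$. If $T$ is a quasi-self-adjoint extension of $\dot A$ with $\rho(T)\neq\emptyset$, a $( * )$-extension of $T$ is $\mathbb A\in[\mathcal H_+,\mathcal H_-]$ with $\mathbb A\supset T\supset\dot A$, $\mathbb A^*\supset T^*\supset\dot A$ and $\mathrm{Re}\,\mathbb A$ a t-self-adjoint bi-extension of $\dot A$. L-system. An array $\Theta=\begin{pmatrix}\mathbb A&K&1\\ \mathcal H_+\subset\mathcal H\subset\mathcal H_-&&\mathbb C\end{pmatrix}$ is an L-system if (1) $T$ is a dissipative ($\mathrm{Im}(Tf,f)\ge0$, $f\in\mathrm{Dom}(T)$) quasi-self-adjoint extension, with $\rho(T)\ne\emptyset$, of a symmetric operator $\dot A$ with deficiency indices $(1,1)$; (2) $\mathbb A$ is a $( * )$-extension of $T$; (3) $\mathrm{Im}\,\mathbb A=KK^*$ with $K\in[\mathbb C,\mathcal H_-]$, $K^*\in[\mathcal H_+,\mathbb C]$. Here $\dot A$, $T$, $\mathbb A$, $K$ are the symmetric, main, state-space and channel operators. Its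 impedance function is $V_\Theta(z)=K^*(\mathrm{Re}\,\mathbb A-zI)^{-1}K$ for nonreal $z\in\rho(T)$, extended analytically to all of $\mathbb C_\pm$. von Neumann parameters (with respect to the given $g_\pm$). For a dissipative quasi-self-adjoint extension $T$: the number $\kappa$, $|\kappa|<1$, with $g_+-\kappa g_-\in\mathrm{Dom}(T)$. For a self-adjoint extension $\hat A$: the number $U$, $|U|=1$, with $g_++Ug_-\in\mathrm{Dom}(\hat A)$. Weyl-Titchmarsh function: for a self-adjoint extension $A$ of $\dot A$, $M_{(\dot A,A)}(z)=((Az+I)(A-zI)^{-1}g,g)$, $z\in\mathbb C_+$, where $g\in\operatorname{Ker}(\dot A^*-iI)$ has $\|g\|=1$ in the norm of $\mathcal H$ (e.g. $g=\sqrt2\,g_+$ for $(+)$-normalized $g_+$). *)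

(* Defs.v *)
From HB Require Import structures.
From mathcomp Require Import all_boot all_order all_algebra.
From mathcomp Require Import boolp classical_sets functions reals.
From mathcomp Require Import topology normedtype derive.
From mathcomp Require Import sesquilinear complex.

Set Implicit Arguments.
Unset Strict Implicit.
Unset Printing Implicit Defensive.

Import Order.TTheory GRing.Theory Num.Theory.
Import numFieldNormedType.Exports.
Local Open Scope classical_set_scope.
Local Open Scope ring_scope.

(* `{dot _ for _}` is linear in its first argument. *)
HB.mixin Record isHilbert (C : numClosedFieldType) H
    of CompleteNormedModule C H := {
  dot : {dot H for (@Num.conj C)};
  dotxx : forall x : H, dot x x = `|x| ^+ 2 }.

#[short(type="hilbertType")]
HB.structure Definition Hilbert (C : numClosedFieldType) :=
  {H of CompleteNormedModule C H & isHilbert C H}.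

(* An unbounded operator T in H is represented by its graph, the set of pairs
   (f, T f); inclusion of graphs is then the extension relation between
   operators. *)
Section Operators.
Context {C : numClosedFieldType} {H : hilbertType C}.
Implicit Types T A : set (H * H).

Definition is_operator T :=
  [/\ T 0,
      forall c p q, T p -> T q -> T (c *: p + q)
    & forall f h h', T (f, h) -> T (f, h') -> h = h'].

Definition domain T : set H := [set f | exists h, T (f, h)].

(* T f, for f in Dom T (and 0 elsewhere). *)
Definition value T (f : H) : H := xget 0 [set h | T (f, h)].

Definition adjoint T : set (H * H) :=
  [set p | forall q, T q -> dot q.2 p.1 = dot q.1 p.2].

Definition symmetric_op T := T `<=` adjoint T.

Definition selfadjoint T :=
  [/\ is_operator T, dense (domain T) & T = adjoint T].

Definition dissipative T := forall f h, T (f, h) -> 0 <= 'Im (dot h f).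

Definition resolvent_set T : set C :=
  [set z | exists B : {linear H -> H}, continuous B /\
    forall h f, T (f, h + z *: f) <-> f = B h].

(* Ker(T^* - z I) *)
Definition deficiency_space T (z : C) : set H :=
  [set f | adjoint T (f, z *: f)].

Definition one_dimensional (E : set H) :=
  exists2 e : H, e != 0 & E = [set f | exists c : C, f = c *: e].

Definition deficiency_indices_11 T :=
  one_dimensional (deficiency_space T 'i) /\
  one_dimensional (deficiency_space T (- 'i)).

Definition quasi_selfadjoint_extension A T :=
  [/\ is_operator T, ~ symmetric_op T, A `<=` T & T `<=` adjoint A].

(* With f = (A - z I)^{-1} g one has (A z + I) f = z A f + f. *)
Definition weyl_titchmarsh A (g : H) (z : C) : C :=
  let f := xget 0 [set f | A (f, g + z *: f)] in
  dot (z *: value A f + f) g.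

End Operators.

Record symop (C : numClosedFieldType) (H : hilbertType C) := SymOp {
  graph :> set (H * H);
  symop_operator : is_operator graph;
  symop_closed : closed graph;
  symop_dense : dense (domain graph);
  symop_sym : symmetric_op graph }.

Section BasicFacts.
Context {C : numClosedFieldType} {H : hilbertType C}.
Implicit Types x y : H.

Lemma dotC x y : dot x y = (dot y x)^*.
Proof. by rewrite hermC /= expr0 mul1r. Qed.

Lemma dotPl c x y (z : H) : dot (c *: x + y) z = c * dot x z + dot y z.
Proof. by rewrite linearPl. Qed.

Lemma dotPr c x y (z : H) : dot z (c *: x + y) = c^* * dot z x + dot z y.
Proof. by rewrite dotC dotPl rmorphD rmorphM /= -!dotC. Qed.

Lemma dot_cauchy_schwarz x y : `|dot x y| <= `|x| * `|y|.
Proof.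
have [->|y0] := eqVneq y 0; first by rewrite linear0r !normr0 mulr0.
have ny : 0 < `|y| by rewrite normr_gt0.
have yy0 : dot y y != 0 by rewrite dotxx expf_neq0 // gt_eqF.
pose c := - (dot x y / dot y y).
have o : dot (c *: y + x) y = 0 by rewrite dotPl mulNr divfK // addNr.
have : 0 <= dot (c *: y + x) (c *: y + x) by rewrite dotxx exprn_ge0.
rewrite dotPr o mulr0 add0r dotPl (dotC y x) mulNr mulrAC -normCK.
rewrite addrC subr_ge0 !dotxx ler_pdivrMr ?exprn_gt0 // -exprMn.
by rewrite ler_pXn2r ?nnegrE ?mulr_ge0.
Qed.

Lemma dense_orthogonal (D : set H) y :
  dense D -> (forall x, D x -> dot x y = 0) -> y = 0.
Proof.
move=> dD yD; apply/eqP/negP => /negP y0.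
have ny : 0 < `|y| by rewrite normr_gt0.
have [x [bx Dx]] := dD _ (ex_intro _ y (ballxx y ny)) (ball_open y `|y|).
have {}bx : `|y - x| < `|y| by have : ball y `|y| x := bx; rewrite -ball_normE.
have := dot_cauchy_schwarz (y - x) y.
rewrite {1}addrC -{1}scaleN1r dotPl yD // mulr0 add0r dotxx normrX normr_id.
rewrite expr2 ler_pM2r //.
by move=> /(lt_le_trans bx); rewrite ltxx.
Qed.

Lemma adjoint0 (T : set (H * H)) : adjoint T 0.
Proof. by move=> q _ /=; rewrite !linear0r. Qed.

Lemma adjointP (T : set (H * H)) c p q :
  adjoint T p -> adjoint T q -> adjoint T (c *: p + q).
Proof. by move=> Tp Tq r Tr /=; rewrite !dotPr Tp // Tq. Qed.

Lemma adjoint_functional (T : set (H * H)) f h h' : dense (domain T) ->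
  adjoint T (f, h) -> adjoint T (f, h') -> h = h'.
Proof.
move=> dT Th Th'; apply/eqP; rewrite -subr_eq0; apply/eqP.
apply: (dense_orthogonal dT) => x [k Tx].
by rewrite linearBr /= -(Th _ Tx) -(Th' _ Tx) subrr.
Qed.

End BasicFacts.

Section Rigging.
Context {C : numClosedFieldType} {H : hilbertType C}.
Variable A : symop H.

(* H_+ = Dom A^* *)
Definition Hplus_pred : {pred H} := fun f => `[< domain (adjoint A) f >].

Lemma Hplus_submod : submod_closed Hplus_pred.
Proof.
split=> [|c f g /asboolP[h Af] /asboolP[k Ag]].
  by apply/asboolP; exists 0; exact: adjoint0.
by apply/asboolP; exists (c *: h + k); exact: (adjointP c Af Ag).
Qed.

HB.instance Definition _ :=
  GRing.isSubmodClosed.Build C H Hplus_pred Hplus_submod.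

Record Hplus := MkHplus { hval :> H; hvalP : hval \in Hplus_pred }.

HB.instance Definition _ := [isSub for hval].
HB.instance Definition _ := [Choice of Hplus by <:].
HB.instance Definition _ := [SubChoice_isSubLmodule of Hplus by <:].

(* A^* f, for f in H_+ *)
Definition astar (f : Hplus) : H := value (adjoint A) f.

Lemma astarP (f : Hplus) : adjoint A (hval f, astar f).
Proof.
have /asboolP[h Af] := hvalP f.
exact: (@xgetPex _ 0 [set k | adjoint A (hval f, k)] (ex_intro _ h Af)).
Qed.

Lemma astar_linear : linear astar.
Proof.
move=> c f g; apply: (adjoint_functional (symop_dense A) (astarP _)).
exact: (adjointP c (astarP f) (astarP g)).
Qed.

Definition dotp (f g : Hplus) : C :=
  dot (hval f) (hval g) + dot (astar f) (astar g).

Definition normp (f : Hplus) : C := sqrtC (dotp f f).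

Lemma dotpp (f : Hplus) : dotp f f = `|hval f| ^+ 2 + `|astar f| ^+ 2.
Proof. by rewrite /dotp !dotxx. Qed.

Lemma normp_ge0 f : 0 <= normp f.
Proof. by rewrite sqrtC_ge0 dotpp addr_ge0 ?exprn_ge0. Qed.

Lemma norm_le_normp (f : Hplus) : `|hval f| <= normp f.
Proof.
rewrite -(ler_pXn2r (isT : (0 < 2)%N)) ?nnegrE ?normp_ge0 // sqrtCK dotpp.
by rewrite lerDl exprn_ge0.
Qed.

Lemma norm_astar_le_normp (f : Hplus) : `|astar f| <= normp f.
Proof.
rewrite -(ler_pXn2r (isT : (0 < 2)%N)) ?nnegrE ?normp_ge0 // sqrtCK dotpp.
by rewrite lerDr exprn_ge0.
Qed.

(* H_- is the space of bounded antilinear functionals on H_+: u in H_- is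
   the functional g |-> (u, g). *)
Definition Hminus_pred : {pred Hplus -> C^o} := fun u =>
  `[< (forall c f g, u (c *: f + g) = c^* * u f + u g) /\
      exists M, forall f, `|u f| <= M * normp f >].

Lemma Hminus_submod : submod_closed Hminus_pred.
Proof.
split=> [|c u v /asboolP[lu [M uM]] /asboolP[lv [N vN]]]; apply/asboolP.
  split=> [d f g|]; first by rewrite /GRing.zero /= mulr0 addr0.
  by exists 0 => f; rewrite mul0r normr0.
split=> [d f g|].
  change (c * u (d *: f + g) + v (d *: f + g) =
    d^* * (c * u f + v f) + (c * u g + v g)).
  by rewrite lu lv !mulrDr !mulrA (mulrC c) -!addrA; congr (_ + _); rewrite addrCA.
exists (`|c| * M + N) => f.
change (`|c * u f + v f| <= (`|c| * M + N) * normp f).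
rewrite (le_trans (ler_normD _ _)) // mulrDl lerD // normrM -mulrA.
by rewrite ler_wpM2l.
Qed.

HB.instance Definition _ :=
  GRing.isSubmodClosed.Build C (Hplus -> C^o) Hminus_pred Hminus_submod.

Record Hminus := MkHminus {
  mval :> Hplus -> C^o; mvalP : mval \in Hminus_pred }.

HB.instance Definition _ := [isSub for mval].
HB.instance Definition _ := [Choice of Hminus by <:].
HB.instance Definition _ := [SubChoice_isSubLmodule of Hminus by <:].

Lemma Hminus_antilinear (u : Hminus) c (f g : Hplus) :
  u (c *: f + g) = c^* * u f + u g.
Proof. by have /asboolP[] := mvalP u. Qed.

Lemma Hminus_bounded (u : Hminus) : exists M, forall f, `|u f| <= M * normp f.
Proof. by have /asboolP[] := mvalP u. Qed.

(* (f, u) for f in H_+ and u in H_- *)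
Definition pairing (f : Hplus) (u : Hminus) : C := (u f)^*.

(* the norm of u in H_- is at most M *)
Definition normm_le (u : Hminus) (M : C) := forall f, `|u f| <= M * normp f.

(* the embedding of H in H_- *)
Definition embed_fun (h : H) : Hplus -> C^o := fun f => dot h (hval f).

Lemma embed_subproof h : embed_fun h \in Hminus_pred.
Proof.
apply/asboolP; split=> [c f g|]; first by rewrite /embed_fun /= dotPr.
exists `|h| => f; rewrite (le_trans (dot_cauchy_schwarz _ _)) //.
by rewrite ler_wpM2l ?norm_le_normp.
Qed.

Definition embed (h : H) : Hminus := MkHminus (embed_subproof h).

Lemma pairing_embed f h : pairing f (embed h) = dot (hval f) h.
Proof. by rewrite /pairing /= -dotC. Qed.

Lemma embed_linear : linear embed.
Proof. by move=> c h k; apply/val_inj/funext => f; rewrite /= /embed_fun dotPl. Qed.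

Definition riesz_berezansky (u : Hminus) : Hplus :=
  xget 0 [set h | forall f, pairing f u = dotp f h].

(* The bounded operators, for gauges nU on U and nV_le on V, where nV_le v M
   says that the norm of v is at most M. *)
Definition bounded_operator (U V : lmodType C)
    (nU : U -> C) (nV_le : V -> C -> Prop) (B : U -> V) :=
  linear B /\ exists M, forall f, nV_le (B f) (M * nU f).

(* [H_+, H_-] *)
Definition bop_pred : {pred Hplus -> Hminus} :=
  fun B => `[< bounded_operator normp normm_le B >].

Lemma bop_submod : submod_closed bop_pred.
Proof.
split=> [|c u v /asboolP[lu [M uM]] /asboolP[lv [N vN]]]; apply/asboolP.
  split=> [d f g|]; first by rewrite /GRing.zero /= scaler0 addr0.
  by exists 0 => f g; rewrite !mul0r normr0.
split=> [d f g|].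
  change (c *: u (d *: f + g) + v (d *: f + g) =
    d *: (c *: u f + v f) + (c *: u g + v g)).
  rewrite lu lv !scalerDr !scalerA (mulrC c) -!addrA; congr (_ + _).
  by rewrite addrCA.
exists (`|c| * M + N) => f g.
change (`|c * u f g + v f g| <= (`|c| * M + N) * normp f * normp g).
rewrite (le_trans (ler_normD _ _)) // !mulrDl lerD ?vN // normrM -!mulrA.
by rewrite ler_wpM2l // mulrA uM.
Qed.

HB.instance Definition _ :=
  GRing.isSubmodClosed.Build C (Hplus -> Hminus) bop_pred bop_submod.

Record bop := MkBop { bval :> Hplus -> Hminus; bvalP : bval \in bop_pred }.

HB.instance Definition _ := [isSub for bval].
HB.instance Definition _ := [Choice of bop by <:].
HB.instance Definition _ := [SubChoice_isSubLmodule of bop by <:].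

Lemma bop_linear (B : bop) : linear B.
Proof. by have /asboolP[] := bvalP B. Qed.

Lemma bop_bounded (B : bop) :
  exists M, forall f g, `|B f g| <= M * normp f * normp g.
Proof. by have /asboolP[] := bvalP B. Qed.

Definition badj_fun (B : bop) (g : Hplus) : Hplus -> C^o :=
  fun f => (B f g)^*.

Lemma badj_fun_subproof B g : badj_fun B g \in Hminus_pred.
Proof.
apply/asboolP; split=> [c f f'|].
  by rewrite /badj_fun bop_linear /= rmorphD rmorphM.
have [M BM] := bop_bounded B; exists (M * normp g) => f.
by rewrite norm_conjC mulrAC.
Qed.

Definition badj_val (B : bop) (g : Hplus) : Hminus :=
  MkHminus (badj_fun_subproof B g).

Lemma badj_subproof B : badj_val B \in bop_pred.
Proof.
apply/asboolP; split=> [c g g'|].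
  apply/val_inj/funext => f /=.
  by rewrite /badj_fun Hminus_antilinear rmorphD rmorphM /= conjCK.
have [M BM] := bop_bounded B; exists M => g f.
by rewrite norm_conjC mulrAC.
Qed.

(* the adjoint with respect to the pairing, see badjP *)
Definition badj (B : bop) : bop := MkBop (badj_subproof B).

Lemma badjP (B : bop) (f g : Hplus) :
  pairing f (badj B g) = (pairing g (B f))^*.
Proof. by rewrite /pairing /= /badj_fun !conjCK. Qed.

Definition bRe (B : bop) : bop := 2^-1 *: (B + badj B).
Definition bIm (B : bop) : bop := (2 * 'i)^-1 *: (B - badj B).

Lemma astar_bop_subproof : (embed \o astar) \in bop_pred.
Proof.
apply/asboolP; split=> [c f g|]; first by rewrite /= astar_linear embed_linear.
exists 1 => f g; rewrite mul1r (le_trans (dot_cauchy_schwarz _ _)) //.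
by rewrite ler_pM ?norm_astar_le_normp ?norm_le_normp.
Qed.

(* A^*, seen as an element of [H_+, H_-] *)
Definition astar_bop : bop := MkBop astar_bop_subproof.

Lemma rank_one_subproof (u v : Hminus) :
  (fun f => pairing f u *: v) \in bop_pred.
Proof.
apply/asboolP; split=> [c f g|].
  by rewrite /pairing Hminus_antilinear rmorphD rmorphM /= conjCK scalerDl scalerA.
have [M uM] := Hminus_bounded u; have [N vN] := Hminus_bounded v.
exists (M * N) => f g; rewrite /= normrM norm_conjC.
by rewrite (mulrAC M) -(mulrA _ N) ler_pM.
Qed.

(* (., u) v *)
Definition rank_one (u v : Hminus) : bop := MkBop (rank_one_subproof u v).

(* [C, H_-] *)
Definition cop_pred : {pred C^o -> Hminus} :=
  fun K => `[< bounded_operator (fun c : C^o => `|c|) normm_le K >].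

Record cop := MkCop {
  cval :> C^o -> Hminus; cvalP : cval \in cop_pred }.

HB.instance Definition _ := [isSub for cval].

Lemma cop_linear (K : cop) : linear K.
Proof. by have /asboolP[] := cvalP K. Qed.

Lemma vector_cop_subproof (u : Hminus) : (fun c => c *: u) \in cop_pred.
Proof.
apply/asboolP; split=> [c d e|]; first by rewrite scalerDl scalerA.
have [M uM] := Hminus_bounded u.
by exists M => c f; rewrite /= normrM -mulrA mulrCA ler_wpM2l.
Qed.

(* the operator c |-> c u *)
Definition vector_cop (u : Hminus) : cop := MkCop (vector_cop_subproof u).

(* K^* : H_+ -> C, see cadjP and cadj_bounded *)
Definition cadj (K : cop) (f : Hplus) : C^o := pairing f (K 1).

Lemma cadjP (K : cop) (f : Hplus) (c : C) :
  pairing f (K c) = cadj K f * c^*.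
Proof.
have K0 : K 0 = 0.
  by have := cop_linear K (-1) 0 0; rewrite scaler0 addr0 scaleN1r addNr.
have := cop_linear K c 1 0.
rewrite K0 !addr0 /GRing.scale /= mulr1 => ->.
by rewrite /cadj /pairing /= rmorphM mulrC.
Qed.

Lemma cadj_bounded (K : cop) :
  bounded_operator normp (fun (c : C^o) M => `|c| <= M) (cadj K).
Proof.
split=> [c f g|].
  by rewrite /cadj /pairing Hminus_antilinear rmorphD rmorphM /= conjCK.
have [M KM] := Hminus_bounded (K 1).
by exists M => f; rewrite norm_conjC.
Qed.

End Rigging.

Section LSystems.
Context {C : numClosedFieldType} {H : hilbertType C}.
Variable A : symop H.
Implicit Types (B : bop A) (T : set (H * H)).

(* B restricted to {f in H_+ | B f in H}, as an operator in H *)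
Definition quasi_kernel B : set (H * H) :=
  [set p | exists2 f : Hplus A, hval f = p.1 & B f = embed A p.2].

(* The operator T in H, Dom T included in H_+, is a restriction of B. *)
Definition extends B T := T `<=` quasi_kernel B.

Definition selfadjoint_biextension B := extends B A /\ B = badj B.

Definition t_selfadjoint_biextension B :=
  selfadjoint_biextension B /\ selfadjoint (quasi_kernel B).

Definition star_extension T B :=
  [/\ extends B T /\ A `<=` T,
      extends (badj B) (adjoint T) /\ A `<=` adjoint T
    & t_selfadjoint_biextension (bRe B)].

Record array := Array {
  state : bop A;
  channel : cop A;
  main : set (H * H) }.

Definition is_Lsystem (Th : array) :=
  [/\ deficiency_indices_11 A,
      [/\ quasi_selfadjoint_extension A (main Th), dissipative (main Th)
        & resolvent_set (main Th) !=set0],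
      star_extension (main Th) (state Th)
    & forall f, bIm (state Th) f = channel Th (cadj (channel Th) f)].

(* f = (Re AA - z I)^{-1} K 1 *)
Definition resolvent_channel (Th : array) (z : C) (f : Hplus A) :=
  bRe (state Th) f - z *: embed A (hval f) = channel Th 1.

(* V(z) = K^* (Re AA - z I)^{-1} K, an operator on C identified with a scalar.
   The last clause pins the analytic extension down also when the resolvent
   set of the main operator misses a half-plane: there V is still given by the
   same expression. *)
Definition is_impedance (Th : array) (V : C^o -> C^o) :=
  [/\ forall z, 'Im z != 0 -> derivable V z 1,
      forall z, 'Im z != 0 -> resolvent_set (main Th) z ->
        exists! f, resolvent_channel Th z f
    & forall z f, 'Im z != 0 -> resolvent_channel Th z f ->
        V z = cadj (channel Th) f].

Definition impedance_coincides (Th : array) (F : C -> C) :=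
  exists2 V, is_impedance Th V & forall z, 0 < 'Im z -> V z = F z.

Section VonNeumann.
Variables gp gm : Hplus A.

Definition von_neumann_kappa T : C -> Prop :=
  unique (fun k => `|k| < 1 /\ domain T (hval gp - k *: hval gm)).

Definition von_neumann_U T : C -> Prop :=
  unique (fun U => `|U| = 1 /\ domain T (hval gp + U *: hval gm)).

End VonNeumann.

Definition state_1a (a : C) (phi psi : Hminus A) : bop A :=
  astar_bop A - ('i / 2) *:
    rank_one ((1 - a) *: phi + (1 + a) *: psi) (phi - psi).

Definition chi_1a (a : C) (phi psi : Hminus A) : Hminus A :=
  (sqrtC (a / 2)) *: (phi - psi).

End LSystems.

(* Main.v *)
(* Write al f = (f, g+)_+ and be f = (f, g-)_+. These are boundary values on
   H_+: both vanish exactly on Dom Adot (von Neumann's formula), and Green's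
   formula reads
     (Adot^* f, g) - (f, Adot^* g) = i (al f conj(al g) - be f conj(be g)).
   As no nonzero combination of phi and psi lies in H, the quasi-kernel of
   Adot^* + (., p phi + q psi) w, with w such a combination, is the restriction
   of Adot^* cut out by a linear relation between al and be. Thus A is
   al + be = 0, the main operator is (1 - a) al + (1 + a) be = 0, and its adjoint
   is (1 + a) al + (1 - a) be = 0. The equation (Re AA - z) f = K 1 says that f is
   the vector of Ker(Adot^* - z) with a prescribed value of al f + be f, which is
   explicit in terms of (A - z)^-1 g+, and its impedance is a M(z).

   Conversely, let Theta be an L-system whose Re AA has quasi-kernel A and whose
   impedance is a M. Symmetry forces Re AA = Adot^* + (., phi + psi) w with w
   known up to one real parameter. The main operator is not symmetric, hence not
   a restriction of A, which forces K 1 to be a multiple of w. The value of the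
   impedance at z = i fixes the remaining parameters, and then every f in the
   domain of the main operator satisfies (1 - a) al f + (1 + a) be f = 0. *)

Require Import Defs.
From HB Require Import structures.
From mathcomp Require Import all_boot all_order all_algebra.
From mathcomp Require Import boolp classical_sets functions reals.
From mathcomp Require Import topology normedtype derive.
From mathcomp Require Import sesquilinear complex.
From mathcomp Require Import ring lra.

Set Implicit Arguments.
Unset Strict Implicit.
Unset Printing Implicit Defensive.

Import Order.TTheory GRing.Theory Num.Theory.
Import numFieldNormedType.Exports.
Local Open Scope classical_set_scope.
Local Open Scope ring_scope.

(** Norms take values in [R[i]] while infima exist in [R]; this moves nonnegative quantities between
    the two. *)
Lemma ge0_ReE (R : realType) (z : R[i]) : 0 <= z -> z = (complex.Re z)%:C%C.
Proof. by case: z => x y; rewrite lecE => /andP[/eqP/= -> _]. Qed.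

(** * Inner product identities *)

Section Orthogonality.
Context {C : numClosedFieldType} {H : hilbertType C}.
Implicit Types x y : H.

Lemma dotDl x y z : dot (x + y) z = dot x z + dot y z :> C.
Proof. by have := dotPl 1 x y z; rewrite scale1r mul1r. Qed.

Lemma dotZl c x z : dot (c *: x) z = c * dot x z :> C.
Proof. by have := dotPl c x 0 z; rewrite addr0 linear0l addr0. Qed.

Lemma dotDr x y z : dot z (x + y) = dot z x + dot z y :> C.
Proof. by rewrite dotC dotDl rmorphD /= -!dotC. Qed.

Lemma dotZr c x z : dot z (c *: x) = c^* * dot z x :> C.
Proof. by rewrite dotC dotZl rmorphM /= -dotC. Qed.

Lemma dotNl x z : dot (- x) z = - dot x z :> C.
Proof. by rewrite -scaleN1r dotZl mulN1r. Qed.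

Lemma dotNr x z : dot z (- x) = - dot z x :> C.
Proof. by rewrite dotC dotNl rmorphN /= -dotC. Qed.

Definition dotE := (dotDl, dotDr, dotZl, dotZr, dotNl, dotNr).

Lemma normsq_proj_sub x y : y != 0 ->
  `|x - (dot x y / dot y y) *: y| ^+ 2 =
    `|x| ^+ 2 - `|dot x y| ^+ 2 / `|y| ^+ 2 :> C.
Proof.
move=> y0; have yy : dot y y != 0 by rewrite dotxx expf_neq0 // normr_eq0.
have cE : (dot x y / dot y y)^* = dot y x / dot y y.
  by rewrite rmorphM fmorphV /= -!dotC.
by rewrite -!dotxx !dotE normCK -dotC cE; field.
Qed.

Lemma parallelogram x y :
  `|x - y| ^+ 2 + `|x + y| ^+ 2 = 2 * `|x| ^+ 2 + 2 * `|y| ^+ 2 :> C.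
Proof. by rewrite -!dotxx !dotE; ring. Qed.

End Orthogonality.

Definition subspace (K : pzRingType) (V : lmodType K) (S : set V) :=
  S 0 /\ forall c x y, S x -> S y -> S (c *: x + y).

(** * Orthogonal projection *)

Section Projection.
Local Open Scope complex_scope.
Context {R : realType} {H : hilbertType R[i]} {S : set H} (y : H).
Hypotheses (sS : subspace S) (cS : closed S).

Let D x := complex.Re (`|y - x| ^+ 2).
Let dist2 := inf (D @` S).

Let DE x : (D x)%:C = `|y - x| ^+ 2.
Proof. by rewrite /D -ge0_ReE ?exprn_ge0. Qed.

Let D_inf : has_inf (D @` S).
Proof.
split; first by exists (D 0), 0 => //; case: sS.
by exists 0 => _ [x _ <-]; rewrite -ler0c DE exprn_ge0.
Qed.

Let dist2_le x : S x -> dist2 <= D x.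
Proof. by move=> Sx; apply: ge_inf; [case: D_inf | exists x]. Qed.

Let near_min e := [set x | S x /\ D x < dist2 + e].

Let near_min_nonempty e : 0 < e -> near_min e !=set0.
Proof. by move=> /inf_adherent /(_ D_inf)[_ [x Sx <-]]; exists x. Qed.

(** Parallelogram law for [y - x] and [y - x']: the midpoint of [x] and [x'] lies in [S], so its
    squared distance to [y] is at least [dist2], which leaves at most 4 (dist2 + e) - 4 dist2. *)
Let near_min_diam e x x' : near_min e x -> near_min e x' ->
  `|x - x'| ^+ 2 <= (4 * e)%:C.
Proof.
move=> [Sx Dx] [Sx' Dx'].
have Sm : S (2^-1 *: x + 2^-1 *: x').
  by case: sS => S0 SP; apply: (SP) => //; rewrite -[_ *: x']addr0; apply: SP.
have := parallelogram (y - x) (y - x').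
have -> : y - x - (y - x') = - (x - x') by rewrite !opprB addrC addrA subrK.
have -> : y - x + (y - x') = (2 : R[i]) *: (y - (2^-1 *: x + 2^-1 *: x')).
  rewrite scalerBr scalerDr !scalerA divff ?pnatr_eq0 // !scale1r.
  by rewrite scaler_nat mulr2n addrACA -opprD.
rewrite normrN normrZ exprMn normr_nat -!DE => /(canRL (addrK _)) ->.
move: (_ + _) (dist2_le Sm) => m Dm.
rewrite -![2]/(2%:R) -!(rmorph_nat (real_complex R)) -rmorphXn -!rmorphM.
rewrite -rmorphD -rmorphB /=.
by rewrite lecR; nra.
Qed.

(** Moving [x] by the best multiple of [s] lowers the squared distance by |(y - x, s)|^2 / |s|^2,
    and a drop of [e] would already pass below [dist2]. *)
Let near_min_dot e x s : near_min e x -> S s ->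
  `|dot (y - x) s| ^+ 2 <= e%:C * `|s| ^+ 2.
Proof.
move=> [Sx Dx] Ss; have [->|s0] := eqVneq s 0.
  by rewrite linear0r !normr0 expr0n mulr0.
rewrite -ler_pdivrMr ?exprn_gt0 ?normr_gt0 //.
pose c := dot (y - x) s / dot s s.
have Sc : S (c *: s + x) by case: sS => _; exact.
have := dist2_le Sc; rewrite -lecR DE opprD addrCA addrC.
rewrite normsq_proj_sub // lerBrDr -lerBrDl => /le_trans; apply.
by rewrite -DE -rmorphB lecR lerBlDl ltW.
Qed.

(** The sets of near-minimizers generate a filter, Cauchy by [near_min_diam]. Its limit lies in the
    closed [S], and the bound of [near_min_dot] yields orthogonality in the limit. *)
Lemma projection_exists : exists2 x, S x & forall s, S s -> dot (y - x) s = 0.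
Proof.
pose F := filter_from [set e : R | 0 < e] near_min.
have FF : ProperFilter F.
  apply: filter_from_proper; last by move=> e; exact: near_min_nonempty.
  apply: filter_from_filter; first by exists 1; exact: ltr01.
  move=> e e' e0 e'0; exists (Num.min e e'); first by rewrite /= lt_min e0.
  move=> x [Sx]; rewrite -ltrBlDl lt_min => /andP[h h'].
  by split; split=> //; rewrite -ltrBlDl.
have Fe e : 0 < e -> F (near_min e) by exists e.
have /cauchy_cvg/cvg_ex[x /= Fx] : cauchy F.
  apply: cauchy_exP => eps eps0; rewrite (ge0_ReE (ltW eps0)).
  have : 0 < complex.Re eps by rewrite -ltcR -ge0_ReE // ltW.
  move: (complex.Re eps) => r r0.
  (* With e = (r/4)^2 the squared diameter is at most r^2/4, below r^2. *)
  have e0 : 0 < (r / 4) ^+ 2 by rewrite exprn_gt0 // divr_gt0.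
  have [x nx] := near_min_nonempty e0; exists x.
  apply: filterS (Fe _ e0) => x' nx'; rewrite -ball_normE /=.
  rewrite -(@ltr_pXn2r _ 2) ?nnegrE ?normr_ge0 ?ler0c 1?ltW //.
  apply: le_lt_trans (near_min_diam nx nx') _; rewrite -rmorphXn ltcR.
  nra.
exists x.
  apply: cS => B /Fx FB; apply: (@filter_ex _ F); apply: (filterI _ FB).
  by apply: filterS (Fe _ ltr01) => ? [].
move=> s Ss; apply/eqP; apply: contraT; rewrite -normr_gt0 => t0.
have s1 : 0 < `|s| + 1 by rewrite ltr_wpDl.
(* The two errors below add up to at most 2 eps |s|; the added 1 makes this strictly less than |(y -
   x, s)|, a contradiction. *)
pose eps := `|dot (y - x) s| / (2 * (`|s| + 1)).
have eps0 : 0 < eps by rewrite divr_gt0 // mulr_gt0.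
have epsE := ge0_ReE (ltW eps0).
have r0 : 0 < complex.Re eps by rewrite -ltcR -epsE.
have e0 : 0 < complex.Re eps ^+ 2 by rewrite exprn_gt0.
have [x' [xx' nx']] : ball x eps `&` near_min (complex.Re eps ^+ 2) !=set0.
  by apply: (@filter_ex _ F); apply: filterI (Fe _ e0); apply: Fx; exact: nbhsx_ballx.
have {}xx' : `|x' - x| < eps.
  by move: xx'; rewrite -ball_normE /= distrC.
have h1 : `|dot (y - x') s| <= eps * `|s|.
  have es : 0 <= eps * `|s| by rewrite mulr_ge0 // ltW.
  have := near_min_dot nx' Ss; rewrite rmorphXn /= -epsE -exprMn.
  by rewrite ler_pXn2r ?nnegrE.
have h2 : `|dot (x' - x) s| <= eps * `|s|.
  by rewrite (le_trans (dot_cauchy_schwarz _ _)) // ler_wpM2r // ltW.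
have := ler_normD (dot (y - x') s) (dot (x' - x) s).
rewrite -dotDl addrA subrK => /le_trans -/(_ _ (lerD h1 h2)).
rewrite -mulrDr -[`|s| + _]mulr2n -[_ *+ 2]mulr_natl mulrA => h.
suff : `|dot (y - x) s| < `|dot (y - x) s| by rewrite ltxx.
apply: (le_lt_trans h); rewrite [ltRHS](_ : _ = eps * 2 * (`|s| + 1)).
  have e2 : 0 < eps * 2 by exact: mulr_gt0.
  by rewrite ltr_pM2l // ltrDl ltr01.
by rewrite -mulrA divfK // lt0r_neq0 // mulr_gt0.
Qed.

End Projection.

(** * Closed symmetric operators and resolvents *)

Section SymmetricOperators.
Context {C : numClosedFieldType} {H : hilbertType C}.
Implicit Types (x y f h : H) (z : C) (T : set (H * H)).

Lemma dotr_continuous y : continuous (dot y : H -> C^o).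
Proof.
move=> x; apply/cvgrPdist_lt => e e0.
have y1 : 0 < `|y| + 1 by rewrite ltr_wpDl.
near=> x'.
have : `|x - x'| < e / (`|y| + 1).
  by near: x'; apply: cvgr_dist_lt => //; rewrite divr_gt0.
rewrite ltr_pdivlMr // => /(le_lt_trans _); apply.
rewrite -dotNr -dotDr (le_trans (dot_cauchy_schwarz _ _)) // mulrC.
by rewrite ler_wpM2l // lerDl.
Unshelve. all: by end_near. Qed.

Lemma adjoint_closed T : closed (adjoint T).
Proof.
have -> : adjoint T =
    \bigcap_(q in T) ((fun p : H * H => dot q.2 p.1 - dot q.1 p.2 : C^o)
      @^-1` [set 0]).
  apply/seteqP; split=> p Tp q Tq; first by rewrite /= Tp ?subrr.
  by have /eqP := Tp q Tq; rewrite subr_eq0 => /eqP.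
apply: closed_bigI => q _.
apply: preimage_closed.
  move=> p _; apply: (@continuousB C C^o _ (fun p : H * H => dot q.2 p.1)
    (fun p : H * H => dot q.1 p.2)).
    apply: (@continuous_comp _ _ _ fst (dot q.2 : H -> C^o)).
      exact: cvg_fst.
    exact: dotr_continuous.
  apply: (@continuous_comp _ _ _ snd (dot q.1 : H -> C^o)).
    exact: cvg_snd.
  exact: dotr_continuous.
apply: accessible_closed_set1; apply: hausdorff_accessible.
exact: norm_hausdorff.
Qed.

Lemma value_unique T f h : is_operator T -> T (f, h) -> value T f = h.
Proof.
move=> [_ _ uT] Tfh; apply: (uT f) => //.
exact: (@xgetPex _ 0 [set k | T (f, k)] (ex_intro _ h Tfh)).
Qed.

Lemma normIm_le z : `|'Im z| <= `|z|.
Proof.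
rewrite -(@ler_pXn2r _ 2) ?nnegrE ?normr_ge0 // real_normK ?Creal_Im //.
by rewrite normC2_Re_Im lerDr real_exprn_even_ge0 ?Creal_Re.
Qed.

Lemma operatorB T f h f' h' : is_operator T ->
  T (f, h) -> T (f', h') -> T (f - f', h - h').
Proof.
move=> [_ TP _] Tf Tf'; have := TP (-1) _ _ Tf' Tf.
by congr T; congr (_, _); rewrite /= scaleN1r addrC.
Qed.

(** As (h, f) and (f, f) are real, Im (h - z f, f) = - Im z |f|^2; Cauchy-Schwarz bounds it by |h -
    z f| |f|. *)
Lemma symmetric_lower_bound T z f h : symmetric_op T -> T (f, h) ->
  `|'Im z| * `|f| <= `|h - z *: f|.
Proof.
move=> sT Tf; have [->|f0] := eqVneq f 0; first by rewrite normr0 mulr0.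
rewrite -(@ler_pM2r _ `|f|) ?normr_gt0 //.
apply: le_trans (dot_cauchy_schwarz _ _).
have hR : dot h f \is Num.real.
  by rewrite CrealE -dotC; apply/eqP; have /= -> := sT _ Tf _ Tf.
have fR : dot f f \is Num.real by rewrite CrealE -dotC.
have -> : `|'Im z| * `|f| * `|f| = `|'Im (dot (h - z *: f) f)|.
  rewrite !dotE raddfB /= (Creal_ImP _ hR) sub0r normrN ImM.
  rewrite (Creal_ImP _ fR) (Creal_ReP _ fR) mulr0 add0r.
  by rewrite normrM dotxx normrX normr_id; ring.
exact: normIm_le.
Qed.

Lemma symmetric_eigen0 T z f : symmetric_op T -> 'Im z != 0 ->
  T (f, z *: f) -> f = 0.
Proof.
move=> sT z0 /(symmetric_lower_bound z sT); rewrite subrr normr0.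
rewrite pmulr_rle0 ?normr_gt0 // => f0; apply/eqP; rewrite -normr_eq0.
by rewrite eq_le f0 normr_ge0.
Qed.

Lemma symmetric_solution_unique T z f f' h : is_operator T -> symmetric_op T ->
  'Im z != 0 -> T (f, h + z *: f) -> T (f', h + z *: f') -> f = f'.
Proof.
move=> oT sT z0 Tf Tf'; apply/eqP; rewrite -subr_eq0; apply/eqP.
apply: (symmetric_eigen0 sT z0); have := operatorB oT Tf Tf'.
by rewrite opprD addrACA subrr add0r scalerBr.
Qed.

(** The range of T - z: with graphs, (T - z) f = h is written T f = h + z f. *)
Definition range_of T z : set H := [set h | exists f, T (f, h + z *: f)].

Lemma range_subspace T z : is_operator T -> subspace (range_of T z).
Proof.
move=> [T0 TP _]; split; first by exists 0; rewrite scaler0 addr0.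
move=> c h h' [f Tf] [f' Tf']; exists (c *: f + f').
have := TP c _ _ Tf Tf'; congr T; congr (_, _) => /=.
by rewrite !scalerDr !scalerA (mulrC c) !addrA; congr (_ + _); rewrite addrAC.
Qed.

(** By the lower bound, the preimages of a convergent filter of values form a Cauchy filter, and the
    limiting pair lies in the closed graph. *)
Lemma range_closed T z : is_operator T -> symmetric_op T -> closed T ->
  'Im z != 0 -> closed (range_of T z).
Proof.
move=> oT sT cT z0 y.
have iz : 0 < `|'Im z| by rewrite normr_gt0.
rewrite closureEcvg => -[G GG [Gy GE]].
have {}GE : G (range_of T z) by apply: GE.
pose u x := xget 0 [set f | T (f, x + z *: f)].
have uP x : range_of T z x -> T (u x, x + z *: u x).
  by move=> rx; exact: (@xgetPex _ 0 [set f | T (f, x + z *: f)] rx).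
have /cauchy_cvg/cvg_ex[f /= uf] : cauchy (u @ G).
  apply: cauchy_exP => e e0.
  have d0 : 0 < `|'Im z| * (e / 2) by rewrite mulr_gt0 // divr_gt0.
  have GB : G (range_of T z `&` ball y (`|'Im z| * (e / 2))).
    by apply: filterI GE _; apply: Gy; exact: nbhsx_ballx.
  have [x [Ex yx]] := filter_ex GB; exists (u x).
  rewrite /fmap /=; apply: filterS GB => x' [Ex' yx'].
  rewrite -ball_normE /= -(ltr_pM2l iz).
  have := symmetric_lower_bound z sT (operatorB oT (uP _ Ex) (uP _ Ex')).
  rewrite opprD addrACA scalerBr addrK => /le_lt_trans; apply.
  have := ball_triangle (ball_sym yx) yx'.
  by rewrite -ball_normE /= -mulrDr -splitr.
exists f.
have Gp : (fun x => (u x, x + z *: u x)) @ G --> (f, y + z *: f).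
  by apply: cvg_pair => //; apply: cvgD => //; apply: cvgZr.
apply: cT => B /Gp GB.
have {}GB : G ((fun x => (u x, x + z *: u x)) @^-1` B) := GB.
have [x [Ex Bx]] := filter_ex (filterI GE GB).
by exists (u x, x + z *: u x); split; first exact: uP.
Qed.

End SymmetricOperators.

(** * Resolvents of self-adjoint operators *)

Section Resolvent.
Context {R : realType} {H : hilbertType R[i]}.
Implicit Types (f h : H) (z : R[i]) (T A : set (H * H)).

(** Subtract from [h] its projection on the closed range of T - z. The difference lies in the
    deficiency space at the conjugate of [z], so it is orthogonal to [h] as well as to the
    projection, hence to itself. *)
Lemma range_of_closed_symmetric T z h : is_operator T -> symmetric_op T ->
  closed T -> 'Im z != 0 ->
  (forall u, deficiency_space T z^* u -> dot h u = 0) -> range_of T z h.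
Proof.
move=> oT sT cT z0 hu.
have [x rx hx] :=
  projection_exists h (range_subspace z oT) (range_closed oT sT cT z0).
suff /eqP : h - x = 0 by rewrite subr_eq0 => /eqP ->.
have du : deficiency_space T z^* (h - x).
  move=> [f k] Tf /=; have rk : range_of T z (k - z *: f) by exists f; rewrite subrK.
  have := hx _ rk; rewrite dotC => /eqP; rewrite conjC_eq0 dotDl dotNl dotZl subr_eq0.
  by rewrite dotZr conjCK => /eqP.
have := hx _ rx; rewrite dotC => /eqP; rewrite conjC_eq0 => /eqP xu.
have /eqP := hu _ du; rewrite -{1}(subrK x h) dotDl xu addr0 dotxx.
by rewrite expf_eq0 normr_eq0 => /eqP.
Qed.

Lemma Im_conj_neq0 z : 'Im z != 0 -> 'Im z^* != 0.
Proof. by rewrite Im_conj oppr_eq0. Qed.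

Lemma selfadjoint_symmetric A : selfadjoint A -> symmetric_op A.
Proof. by move=> [_ _ AE]; rewrite /symmetric_op -AE. Qed.

Lemma selfadjoint_surjective A z h : selfadjoint A -> 'Im z != 0 ->
  range_of A z h.
Proof.
move=> sA z0; have [oA _ AE] := sA; have symA := selfadjoint_symmetric sA.
apply: range_of_closed_symmetric => //; first by rewrite AE; exact: adjoint_closed.
move=> u; rewrite /deficiency_space /= -AE => Au.
by rewrite (symmetric_eigen0 symA (Im_conj_neq0 z0) Au) linear0r.
Qed.

(** The same choice as inside [weyl_titchmarsh], which can therefore be folded into it. *)
Definition resolvent A z h : H := xget 0 [set f | A (f, h + z *: f)].

Section Selfadjoint.
Context {A : set (H * H)} (sA : selfadjoint A).
Let oA : is_operator A. Proof. by case: sA. Qed.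
Let symA := selfadjoint_symmetric sA.

Lemma resolventP z h : 'Im z != 0 ->
  A (resolvent A z h, h + z *: resolvent A z h).
Proof.
move=> z0; exact: (@xgetPex _ 0 [set f | A (f, h + z *: f)]
  (selfadjoint_surjective h sA z0)).
Qed.

Lemma resolvent_unique z h f : 'Im z != 0 -> A (f, h + z *: f) ->
  f = resolvent A z h.
Proof.
move=> z0 Af; exact: (symmetric_solution_unique oA symA z0 Af (resolventP h z0)).
Qed.

Lemma resolvent_linear z : 'Im z != 0 -> linear (resolvent A z).
Proof.
move=> z0 c h k; apply/esym/resolvent_unique => //.
have [_ AP _] := oA; have := AP c _ _ (resolventP h z0) (resolventP k z0).
congr A; congr (_, _) => /=.
by rewrite !scalerDr !scalerA (mulrC c) !addrA; congr (_ + _); rewrite addrAC.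
Qed.

Lemma resolvent_bound z h : 'Im z != 0 ->
  `|resolvent A z h| <= `|h| / `|'Im z|.
Proof.
move=> z0; rewrite ler_pdivlMr ?normr_gt0 // mulrC.
by have := symmetric_lower_bound z symA (resolventP h z0); rewrite addrK.
Qed.

Lemma resolvent_identity z w h : 'Im z != 0 -> 'Im w != 0 ->
  resolvent A z h - resolvent A w h =
    (z - w) *: resolvent A z (resolvent A w h).
Proof.
move=> z0 w0; set r := resolvent A w h.
suff -> : resolvent A z h = r + (z - w) *: resolvent A z r by rewrite addrC addKr.
apply/esym/resolvent_unique => //.
have [_ AP _] := oA; have := AP (z - w) _ _ (resolventP r z0) (resolventP h w0).
congr A; congr (_, _) => /=; first by rewrite addrC.
rewrite -/r !scalerDr !scalerA (mulrC z).
have -> : z *: r = (z - w) *: r + w *: r by rewrite -scalerDl subrK.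
by rewrite addrCA; congr (_ + _); rewrite addrAC.
Qed.

End Selfadjoint.
End Resolvent.

Section ResolventDerivable.
Context {R : realType} {H : hilbertType R[i]} {A : set (H * H)}.
Hypothesis sA : selfadjoint A.

(** Two uses of the resolvent identity turn the difference quotient minus its limit into h (R(w + h)
    r', k). For |h| < |Im w| / 2 the resolvent at w + h is bounded by 2 / |Im w|, so this is at most
    |h| [K]. *)
Lemma resolvent_derivable (g k : H) (w : R[i]) : 'Im w != 0 ->
  derivable (fun z : R[i]^o => dot (resolvent A z g) k : R[i]^o) w 1.
Proof.
move=> w0; pose r := resolvent A w g; pose r' := resolvent A w r.
have iw : 0 < `|'Im w| by rewrite normr_gt0.
apply/cvg_ex; exists (dot r' k); apply/cvgrPdist_lt => e e0.
pose K := `|r'| * `|k| / (`|'Im w| / 2).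
have K1 : 0 < K + 1 by rewrite ltr_wpDl // !mulr_ge0 ?invr_ge0 ?mulr_ge0 ?invr_ge0.
near=> h.
have h0 : h != 0 by near: h; exact: nbhs_dnbhs_neq.
have hw : `|h| < `|'Im w| / 2.
  by near: h; apply: dnbhs0_lt; rewrite divr_gt0.
have he : `|h| < e / (K + 1) by near: h; apply: dnbhs0_lt; rewrite divr_gt0.
have hwI : `|'Im w| / 2 <= `|'Im (h + w)|.
  rewrite raddfD /= addrC; apply: le_trans (lerB_normD _ _).
  rewrite lerBrDr -lerBrDl [leRHS](_ : _ = `|'Im w| / 2); last first.
    by rewrite [X in X - _]splitr addrK.
  exact: le_trans (normIm_le _) (ltW hw).
have hw0 : 'Im (h + w) != 0.
  by rewrite -normr_gt0 (lt_le_trans _ hwI) // divr_gt0.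
rewrite /= /GRing.scale /= mulr1 -dotNl -dotDl (resolvent_identity sA) //.
rewrite addrK dotZl mulKf // -/r -normrN opprB -dotNl -dotDl.
rewrite (resolvent_identity sA) // addrK -/r' dotZl normrM.
rewrite -[ltRHS](divfK (lt0r_neq0 K1)).
apply: le_lt_trans (_ : `|h| * (K + 1) < _); last by rewrite ltr_pM2r.
rewrite ler_wpM2l // (le_trans (dot_cauchy_schwarz _ _)) //.
rewrite (@le_trans _ _ K) ?lerDl // /K mulrAC ler_wpM2r //.
rewrite (le_trans (resolvent_bound sA _ _)) // ler_wpM2l //.
by rewrite lef_pV2 // posrE ?normr_gt0 // divr_gt0.
Unshelve. all: by end_near. Qed.

End ResolventDerivable.

(** * Boundary values in the rigged space *)

Section RiggedSpace.
Context {C : numClosedFieldType} {H : hilbertType C} {Adot : symop H}.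
Implicit Types (f g : Hplus Adot) (u v : Hminus Adot) (B : bop Adot).

Lemma astar_unique f h : adjoint Adot (hval f, h) -> astar f = h.
Proof. exact: (adjoint_functional (symop_dense Adot) (astarP f)). Qed.

Lemma adjoint_Hplus x h : adjoint Adot (x, h) ->
  exists2 f : Hplus Adot, hval f = x & astar f = h.
Proof.
move=> Af; have xP : x \in Hplus_pred Adot by apply/asboolP; exists h.
by exists (MkHplus xP) => //; exact: astar_unique.
Qed.

Lemma symop_Hplus x h : graph Adot (x, h) ->
  exists2 f : Hplus Adot, hval f = x & astar f = h.
Proof. by move=> /(@symop_sym _ _ Adot)/adjoint_Hplus. Qed.

Lemma hval_inj : injective (@hval _ _ Adot).
Proof. exact: val_inj. Qed.

Lemma astarD f g : astar (f + g) = astar f + astar g.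
Proof. by have := astar_linear 1 f g; rewrite !scale1r. Qed.

Lemma astarZ c f : astar (c *: f) = c *: astar f.
Proof.
have a0 : astar (0 : Hplus Adot) = 0.
  by have := astar_linear (-1) (0 : Hplus Adot) 0; rewrite scaler0 addr0 scaleN1r addNr.
by have := astar_linear c f 0; rewrite !addr0 a0 addr0.
Qed.

Lemma astarN f : astar (- f) = - astar f.
Proof. by rewrite -scaleN1r astarZ scaleN1r. Qed.

Lemma dotpDl f g h : dotp (f + g) h = dotp f h + dotp g h.
Proof. by rewrite /dotp astarD !dotDl addrACA. Qed.

Lemma dotpZl c f h : dotp (c *: f) h = c * dotp f h.
Proof. by rewrite /dotp astarZ !dotZl mulrDr. Qed.

Lemma dotpNl f h : dotp (- f) h = - dotp f h.
Proof. by rewrite -scaleN1r dotpZl mulN1r. Qed.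

Lemma dotpC f g : dotp f g = (dotp g f)^*.
Proof. by rewrite /dotp rmorphD /= -!dotC. Qed.

Lemma normp1 f : normp f = 1 -> dotp f f = 1.
Proof. by rewrite /normp => f1; rewrite -[LHS]sqrtCK f1 expr1n. Qed.

Lemma deficiency_astar z f : deficiency_space Adot z (hval f) ->
  astar f = z *: hval f.
Proof. exact: astar_unique. Qed.

Lemma deficiency_neq0 z f : deficiency_space Adot z (hval f) -> normp f = 1 ->
  hval f != 0.
Proof.
move=> fE /normp1 f1; apply/eqP => f0; move: f1.
rewrite /dotp (deficiency_astar fE) f0 scaler0 linear0r addr0 => /esym/eqP.
by rewrite oner_eq0.
Qed.

(** The second term of the (+)-product is the conjugate of z^2, that is -1, times the first. *)
Lemma dotp_deficiency z f g : z ^+ 2 = -1 -> deficiency_space Adot z (hval g) ->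
  graph Adot (hval f, astar f) -> dotp f g = 0.
Proof.
move=> z2 gz Af; rewrite /dotp (deficiency_astar gz) dotZr.
have /= -> := gz _ Af; rewrite dotZr mulrA -expr2 -rmorphXn z2.
by rewrite rmorphN rmorph1 mulN1r subrr.
Qed.

Lemma Hminus0 u : (forall f, u f = 0) -> u = 0.
Proof. by move=> u0; apply/val_inj/funext => f; exact: u0. Qed.

Lemma HminusE u v : (forall f, u f = v f) -> u = v.
Proof. by move=> uv; apply/val_inj/funext => f; exact: uv. Qed.

Lemma bopE B B' : (forall f g, B f g = B' f g) -> B = B'.
Proof. by move=> BB; apply/val_inj/funext => f; apply: HminusE => g; exact: BB. Qed.

Lemma bopD B B' f : (B + B') f = B f + B' f. Proof. by []. Qed.
Lemma bopZ c B f : (c *: B) f = c *: B f. Proof. by []. Qed.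
Lemma bopN B f : (- B) f = - B f. Proof. by []. Qed.
Lemma HminusD u v f : (u + v) f = u f + v f. Proof. by []. Qed.
Lemma HminusZ c u f : (c *: u) f = c * u f. Proof. by []. Qed.
Lemma HminusN u f : (- u) f = - u f. Proof. by []. Qed.

Lemma embedE h f : embed Adot h f = dot h (hval f). Proof. by []. Qed.

Lemma HminusDr u f g : u (f + g) = u f + u g.
Proof. by have := Hminus_antilinear u 1 f g; rewrite scale1r rmorph1 mul1r. Qed.

Lemma HminusZr u c f : u (c *: f) = c^* * u f.
Proof.
have u0 : u 0 = 0.
  have := Hminus_antilinear u (-1) 0 0.
  by rewrite scaler0 addr0 rmorphN rmorph1 mulN1r addNr.
by have := Hminus_antilinear u c f 0; rewrite !addr0 u0 addr0.
Qed.

Lemma embed_inj : injective (@embed _ _ Adot).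
Proof.
move=> h k hk; apply/eqP; rewrite -subr_eq0; apply/eqP.
apply: (dense_orthogonal (symop_dense Adot)) => x [h0 Ax].
have [f <- _] := symop_Hplus Ax.
have : embed Adot h f = embed Adot k f by rewrite hk.
rewrite !embedE dotDr dotNr (dotC (hval f) h) (dotC (hval f) k) => ->.
by rewrite subrr.
Qed.

Lemma embed_annihilator u h :
  (forall f, graph Adot (hval f, astar f) -> u f = 0) -> u = embed Adot h -> u = 0.
Proof.
move=> u0 uh; suff h0 : h = 0.
  by apply: Hminus0 => f; rewrite uh h0 /= /embed_fun linear0l.
apply: (dense_orthogonal (symop_dense Adot)) => x [h0 Ax].
have [f ff hf] := symop_Hplus Ax; have := u0 f; rewrite ff hf uh => /(_ Ax).
by rewrite /= /embed_fun ff dotC => /eqP; rewrite conjC_eq0 => /eqP.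
Qed.

Lemma embed_linearB h k : embed Adot (h - k) = embed Adot h - embed Adot k.
Proof. by have := embed_linear Adot (-1) k h; rewrite !scaleN1r ![- _ + _]addrC. Qed.

Lemma embed_linearZ c h : embed Adot (c *: h) = c *: embed Adot h.
Proof. by apply: HminusE => f; rewrite HminusZ /= /embed_fun dotZl. Qed.

(** A functional from H that vanishes on the dense Dom Adot is zero, so [u] is not in H. Equations
    in H_- thus split into a part in H and a coefficient of [u]. *)
Lemma embed_eq_annihilator u c h : u != 0 ->
  (forall f, graph Adot (hval f, astar f) -> u f = 0) ->
  embed Adot h = c *: u -> c = 0 /\ h = 0.
Proof.
move=> u0 uA hu; suff c0 : c = 0.
  split=> //; apply: embed_inj; rewrite hu c0 scale0r.
  by apply: HminusE => f; rewrite /= /embed_fun linear0l.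
apply/eqP; apply: contraNT u0 => c0; apply/eqP.
apply: (@embed_annihilator _ (c^-1 *: h)) => //.
by rewrite embed_linearZ hu scalerA mulVf // scale1r.
Qed.

(** A nonzero value cannot be the default 0 of the choice, so it is a genuine representing
    vector. *)
Lemma riesz_berezansky_pairing u f : f != 0 -> riesz_berezansky u = f ->
  forall k, pairing k u = dotp k f.
Proof.
rewrite /riesz_berezansky; case: xgetP => [h _ hu _ <- //|_ f0 uf].
by move: f0; rewrite uf eqxx.
Qed.

End RiggedSpace.

(** * Von Neumann's formula *)

Section Decomposition.
Context {R : realType} {H : hilbertType R[i]} {Adot : symop H}.
Variables gp gm : Hplus Adot.
Hypotheses (d11 : deficiency_indices_11 Adot)
  (gpE : deficiency_space Adot 'i (hval gp)) (gp1 : normp gp = 1)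
  (gmE : deficiency_space Adot (- 'i) (hval gm)) (gm1 : normp gm = 1).

Lemma one_dimensional_span (E : set H) x y : one_dimensional E -> E x ->
  x != 0 -> E y -> exists c : R[i], y = c *: x.
Proof.
move=> [e e0 ->] [c ->] x0 [d ->].
have c0 : c != 0 by apply: contraNneq x0 => ->; rewrite scale0r.
by exists (d / c); rewrite scalerA divfK.
Qed.

(** Orthogonality to g+ makes (Adot + i) F0 = Adot^* f + i f solvable in Dom Adot. Then f - F0 lies
    in Ker(Adot^* + i), a multiple of g-, and orthogonality to g- makes it zero. *)
Lemma von_neumann_formula f : dotp f gp = 0 -> dotp f gm = 0 ->
  graph Adot (hval f, astar f).
Proof.
move=> fgp fgm.
have gp0 := deficiency_neq0 gpE gp1.
have gm0 := deficiency_neq0 gmE gm1.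
have [f0] : range_of Adot (- 'i) (astar f + 'i *: hval f).
  apply: range_of_closed_symmetric.
  - exact: symop_operator.
  - exact: symop_sym.
  - exact: symop_closed.
  - by rewrite raddfN /= Im_i oppr_eq0 oner_eq0.
  rewrite rmorphN /= conjCi opprK => u du.
  have [c ->] := one_dimensional_span d11.1 gpE gp0 du.
  (* The number i (f, g+)_+ equals (Adot^* f + i f, g+). *)
  rewrite dotZr; have : 'i * dotp f gp = 0 by rewrite fgp mulr0.
  rewrite /dotp (deficiency_astar gpE) dotZr conjCi mulrDr !mulNr mulrN mulrA.
  rewrite -expr2 sqrCi.
  by rewrite mulN1r opprK dotDl dotZl addrC => ->; rewrite mulr0.
move=> Af0; have [F0 F0f F0h] := symop_Hplus Af0.
have dF : deficiency_space Adot (- 'i) (hval (f - F0)).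
  have := astarP (f - F0); congr adjoint; congr (_, _).
  rewrite astarD astarN F0h /= -F0f opprD opprD addrA addrA subrr add0r.
  by rewrite scalerBr !scaleNr opprK.
have [c fF] := one_dimensional_span d11.2 gmE gm0 dF.
have {}Af0 : graph Adot (hval F0, astar F0) by rewrite F0f F0h.
have F0gm : dotp F0 gm = 0 by apply: dotp_deficiency gmE Af0; rewrite sqrrN sqrCi.
have {}fF : f - F0 = c *: gm by apply: hval_inj; exact: fF.
have : dotp (f - F0) gm = 0 by rewrite dotpDl dotpNl fgm F0gm subr0.
rewrite fF dotpZl normp1 // mulr1 => c0; move: fF.
by rewrite c0 scale0r => /eqP; rewrite subr_eq0 => /eqP ->.
Qed.

End Decomposition.

Section BoundaryValues.
Context {C : numClosedFieldType} {H : hilbertType C} {Adot : symop H}.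
Variables gp gm : Hplus Adot.
Hypotheses
  (gpE : deficiency_space Adot 'i (hval gp)) (gp1 : normp gp = 1)
  (gmE : deficiency_space Adot (- 'i) (hval gm)) (gm1 : normp gm = 1)
  (dec : forall f : Hplus Adot, dotp f gp = 0 -> dotp f gm = 0 ->
     graph Adot (hval f, astar f)).
Implicit Types (f g : Hplus Adot) (u v w : Hminus Adot) (B : bop Adot).
Implicit Types T : set (H * H).

(* f = f0 + (al f) g+ + (be f) g- with f0 in Dom Adot, and (f, phi) = al f,
   (f, psi) = be f for the functionals phi, psi of the theorem. *)
Local Notation al f := (dotp f gp).
Local Notation be f := (dotp f gm).

Lemma al_domain f : graph Adot (hval f, astar f) -> al f = 0.
Proof. by apply: dotp_deficiency gpE; rewrite sqrCi. Qed.

Lemma be_domain f : graph Adot (hval f, astar f) -> be f = 0.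
Proof. by apply: dotp_deficiency gmE; rewrite sqrrN sqrCi. Qed.

Lemma al_gp : al gp = 1. Proof. exact: normp1. Qed.
Lemma be_gm : be gm = 1. Proof. exact: normp1. Qed.

Lemma be_gp : be gp = 0.
Proof.
rewrite /dotp (deficiency_astar gpE) (deficiency_astar gmE) dotZl dotZr.
by rewrite rmorphN /= conjCi opprK mulrA -expr2 sqrCi mulN1r subrr.
Qed.

Lemma al_gm : al gm = 0.
Proof. by rewrite dotpC be_gp rmorph0. Qed.

Lemma dot_gp : dot (hval gp) (hval gp) = 2^-1.
Proof.
have := al_gp; rewrite /dotp (deficiency_astar gpE) dotZl dotZr conjCi mulrA.
rewrite mulrN -expr2 sqrCi opprK mul1r -mulr2n -[dot _ _ *+ 2]mulr_natl => h.
by apply: (@mulfI _ 2); rewrite ?pnatr_eq0 // h divff ?pnatr_eq0.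
Qed.

Lemma dot_gm : dot (hval gm) (hval gm) = 2^-1.
Proof.
have := be_gm; rewrite /dotp (deficiency_astar gmE) dotZl dotZr rmorphN /= conjCi.
rewrite mulrA mulNr opprK -expr2 sqrCi opprK mul1r -mulr2n -[dot _ _ *+ 2]mulr_natl => h.
by apply: (@mulfI _ 2); rewrite ?pnatr_eq0 // h divff ?pnatr_eq0.
Qed.

Definition interior_part f : Hplus Adot := f - (al f *: gp + be f *: gm).

Lemma interior_partP f : graph Adot (hval (interior_part f), astar (interior_part f)).
Proof.
apply: dec; rewrite dotpDl dotpNl dotpDl !dotpZl ?al_gp ?be_gp ?al_gm ?be_gm.
  by rewrite mulr1 mulr0 addr0 subrr.
by rewrite mulr1 mulr0 add0r subrr.
Qed.

Lemma interior_partE f : f = interior_part f + (al f *: gp + be f *: gm).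
Proof. by rewrite subrK. Qed.

Definition green f g := dot (astar f) (hval g) - dot (hval f) (astar g).

Lemma greenDl f f' g : green (f + f') g = green f g + green f' g.
Proof. by rewrite /green astarD !dotDl /=; ring. Qed.
Lemma greenZl c f g : green (c *: f) g = c * green f g.
Proof. by rewrite /green astarZ !dotZl; ring. Qed.
Lemma greenC f g : green g f = - (green f g)^*.
Proof. by rewrite /green rmorphB /= -!dotC opprB. Qed.
Lemma green_domain f g : graph Adot (hval f, astar f) -> green f g = 0.
Proof. by move=> Af; have /= := astarP g Af; rewrite /green => ->; rewrite subrr. Qed.

(** The form vanishes as soon as one argument is in Dom Adot, so its values on g+ and g-, namely i,
    -i and 0 off the diagonal, determine it. *)
Lemma green_formula f g : green f g = 'i * (al f * (al g)^* - be f * (be g)^*).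
Proof.
have red h k : green h k = al h * green gp k + be h * green gm k.
  rewrite {1}(interior_partE h) greenDl (green_domain _ (interior_partP h)).
  by rewrite add0r greenDl !greenZl.
have gpp : green gp gp = 'i.
  rewrite /green (deficiency_astar gpE) dotZl dotZr dot_gp conjCi.
  by rewrite mulNr opprK -splitr.
have gmm : green gm gm = - 'i.
  rewrite /green (deficiency_astar gmE) dotZl dotZr dot_gm rmorphN /= conjCi.
  by rewrite opprK mulNr -opprD -splitr.
have gpm : green gp gm = 0.
  rewrite /green (deficiency_astar gpE) (deficiency_astar gmE) dotZl dotZr.
  by rewrite rmorphN /= conjCi opprK subrr.
rewrite red (greenC g gp) (greenC g gm) !(red g) gpp (greenC gp gm) gpm gmm.
rewrite rmorph0 oppr0 !mulr0 addr0 add0r !rmorphM rmorphN /= conjCi.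
by ring.
Qed.

Definition boundary_extension (p q : C) : set (H * H) :=
  [set x | exists f : Hplus Adot,
     [/\ hval f = x.1, astar f = x.2 & p * al f + q * be f = 0]].

Local Notation bext := boundary_extension.

Lemma boundary_extension_operator p q : is_operator (boundary_extension p q).
Proof.
split=> [|c [x h] [y k] [f [/= <- <- fpq]] [g [/= <- <- gpq]]|].
- have A0 : graph Adot (0, 0) by case: (symop_operator Adot).
  have [f f0 h0] := symop_Hplus A0.
  have Af : graph Adot (hval f, astar f) by rewrite f0 h0.
  by exists f; rewrite al_domain // be_domain // !mulr0 addr0.
- exists (c *: f + g); split=> //=; first by rewrite astarD astarZ.
  rewrite !dotpDl !dotpZl.
  transitivity (c * (p * al f + q * be f) + (p * al g + q * be g)).
    by ring.
  by rewrite fpq gpq mulr0 addr0.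
move=> x h h' [f [/= fx <- _]] [g [/= gx <- _]].
by congr astar; apply: hval_inj; rewrite fx gx.
Qed.

Lemma symop_boundary_extension p q : Adot `<=` boundary_extension p q.
Proof.
move=> [x h] Ax; have [f fx fh] := symop_Hplus Ax.
have Af : graph Adot (hval f, astar f) by rewrite fx fh.
by exists f; rewrite al_domain // be_domain // !mulr0 addr0.
Qed.

Lemma boundary_extension_adjoint p q : boundary_extension p q `<=` adjoint Adot.
Proof. by move=> [x h] [f [/= <- <- _]]; exact: astarP. Qed.

Lemma boundary_extensionP p q f :
  boundary_extension p q (hval f, astar f) <-> p * al f + q * be f = 0.
Proof.
by split=> [[g [/= /hval_inj -> _]]//|]; exists f.
Qed.

Lemma boundary_extension_domain p q f :
  domain (boundary_extension p q) (hval f) <-> p * al f + q * be f = 0.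
Proof.
split=> [[h [g [/= /hval_inj -> _]]]//|fpq]; exists (astar f).
exact/boundary_extensionP.
Qed.

(** One test vector suffices: [g] has boundary values (q, -p), and Green's formula turns the adjoint
    relation with [g] into the swapped and conjugated condition. *)
Lemma adjoint_boundary_extension p q :
  adjoint (boundary_extension p q) `<=` boundary_extension q^* p^*.
Proof.
move=> [x h] Ax.
have [f fx fh] : exists2 f : Hplus Adot, hval f = x & astar f = h.
  by apply: adjoint_Hplus => y Ay; apply: Ax; exact: symop_boundary_extension.
exists f; split=> //; pose g := q *: gp - p *: gm.
have alg : al g = q by rewrite dotpDl dotpNl !dotpZl al_gp al_gm mulr1 mulr0 subr0.
have beg : be g = - p by rewrite dotpDl dotpNl !dotpZl be_gp be_gm mulr1 mulr0 sub0r.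
have Tg : boundary_extension p q (hval g, astar g).
  by apply/boundary_extensionP; rewrite alg beg; ring.
have /= := Ax _ Tg; rewrite -fx -fh => /eqP; rewrite -subr_eq0 -/(green _ _).
rewrite green_formula alg beg mulf_eq0 (negPf (neq0Ci C)) /= => /eqP.
move=> /(congr1 Num.conj); rewrite rmorph0 => <-.
by rewrite rmorphB !rmorphM !rmorphN /= !conjCK; ring.
Qed.

(** The condition leaves a line of boundary values. A non-symmetric [T] has a vector outside Dom
    Adot, whose boundary values span that line; every other admissible vector is a multiple of it
    modulo Dom Adot. *)
Lemma extension_in_boundary_extension p q T : (p != 0) || (q != 0) ->
  is_operator T -> ~ symmetric_op T -> Adot `<=` T ->
  T `<=` boundary_extension p q -> T = boundary_extension p q.
Proof.
move=> pq0 oT nsT AT TB; apply/seteqP; split=> // -[y k] [g [/= <- <- gpq]].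
have [x Tx nAx] : exists2 x, T x & ~ graph Adot x.
  apply: contrapT => nT; apply: nsT; have TA : T `<=` Adot.
    by move=> x Tx; apply: contrapT => nAx; apply: nT; exists x.
  move=> x /TA/(@symop_sym _ _ Adot) Ax z /TA; exact: Ax.
have [f [fx fh fpq]] := TB _ Tx.
have Tf : T (hval f, astar f) by rewrite fx fh -surjective_pairing.
have [c [gal gbe]] : exists c, al g = c * al f /\ be g = c * be f.
  have : (al f != 0) || (be f != 0).
    rewrite -negb_and; apply: contra_notN nAx => /andP[/eqP f1 /eqP f2].
    by rewrite [x]surjective_pairing -fx -fh; exact: dec.
  (* Two solutions of one nontrivial linear equation in two unknowns have zero determinant. *)
  have det : al g * be f = al f * be g.
    apply/eqP; rewrite -subr_eq0; case/orP: pq0 => [p0|q0].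
      rewrite -(mulrI_eq0 _ (mulfI p0)); apply/eqP.
      have -> : p * (al g * be f - al f * be g) =
          (p * al g + q * be g) * be f - (p * al f + q * be f) * be g by ring.
      by rewrite gpq fpq !mul0r subrr.
    rewrite -(mulrI_eq0 _ (mulfI q0)); apply/eqP.
    have -> : q * (al g * be f - al f * be g) =
        (p * al f + q * be f) * al g - (p * al g + q * be g) * al f by ring.
    by rewrite gpq fpq !mul0r subrr.
  case/orP => [f1|f2]; [exists (al g / al f)|exists (be g / be f)].
    by rewrite divfK // mulrAC det [al f * _]mulrC mulfK.
  by rewrite divfK // mulrAC [be g * al _]mulrC -det mulfK.
have Ag : graph Adot (hval (g - c *: f), astar (g - c *: f)).
  by apply: dec; rewrite dotpDl dotpNl dotpZl ?gal ?gbe subrr.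
have [_ TP _] := oT; have := TP c _ _ Tf (AT _ Ag); congr T; congr (_, _) => /=.
  by rewrite addrC subrK.
by rewrite astarD astarN astarZ addrC subrK.
Qed.

Lemma quasi_kernel_boundary B p q u :
  u != 0 -> (forall f, graph Adot (hval f, astar f) -> u f = 0) ->
  (forall f, B f = embed Adot (astar f) + (p * al f + q * be f) *: u) ->
  quasi_kernel B = boundary_extension p q.
Proof.
move=> u0 uA BE; apply/seteqP; split=> [[x h] [f /= fx /= Bf]|[x h] [f [/= fx fh l0]]].
  have : embed Adot (h - astar f) = (p * al f + q * be f) *: u.
    by rewrite embed_linearB -Bf BE addrAC subrr add0r.
  move=> /(embed_eq_annihilator u0 uA)[l0 /eqP]; rewrite subr_eq0 => /eqP ->.
  by exists f.
by exists f => //=; rewrite BE l0 scale0r addr0 fh.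
Qed.

(** * Bi-extensions and L-systems *)

(** Vanishing of Green's form against g+ - g- is exactly al f + be f = 0; conversely such an [f] is
    al f (g+ - g-) modulo Dom Adot. *)
Lemma selfadjoint_boundary_extension A : selfadjoint A -> Adot `<=` A ->
  domain A (hval gp - hval gm) -> A = bext 1 1.
Proof.
move=> [oA _ AE] AA [k Ak].
have Aadj : A `<=` adjoint Adot by rewrite AE => x Ax q /AA; exact: Ax.
have kE : astar (gp - gm) = k by apply: astar_unique; exact: Aadj.
have {}Ak : A (hval (gp - gm), astar (gp - gm)) by rewrite kE.
have ag : al (gp - gm) = 1 by rewrite dotpDl dotpNl al_gp al_gm subr0.
have bg : be (gp - gm) = -1 by rewrite dotpDl dotpNl be_gp be_gm sub0r.
apply/seteqP; split=> [[x h] Ax|[x h] [f [/= <- <-]]].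
  have [f fx fh] := adjoint_Hplus (Aadj _ Ax); exists f; split=> //.
  have : green f (gp - gm) = 0.
    move: (Ax); rewrite AE => /(_ _ Ak) /=; rewrite /green fx fh => e.
    by rewrite (dotC h) -e -dotC subrr.
  rewrite green_formula // ag bg rmorphN !rmorph1 mulrN opprK !mulr1 !mul1r.
  by move=> /eqP; rewrite mulf_eq0 (negPf (neq0Ci C)) => /eqP.
rewrite !mul1r => f0.
have Af : graph Adot (hval (f - al f *: (gp - gm)), astar (f - al f *: (gp - gm))).
  apply: dec; rewrite dotpDl dotpNl dotpZl ?ag ?bg ?mulr1 ?subrr //.
  by rewrite mulrN1 opprK addrC.
have [_ AP _] := oA; have := AP (al f) _ _ Ak (AA _ Af); congr A; congr (_, _) => /=.
  by rewrite addrC subrK.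
by rewrite [astar (f - _)]astarD astarN astarZ addrC subrK.
Qed.

Lemma bop_ReIm B f : B f = bRe B f + 'i *: bIm B f.
Proof.
rewrite /bRe /bIm !bopZ !bopD bopN scalerA.
rewrite (_ : 'i * (2 * 'i)^-1 = 2^-1); last first.
  by rewrite invfM mulrCA divff ?mulr1 ?neq0Ci.
rewrite -scalerDr addrACA subrr addr0 -mulr2n -[B f *+ 2]scaler_nat.
by rewrite scalerA mulVf ?pnatr_eq0 ?scale1r.
Qed.

Lemma badj_bRe B : badj (bRe B) = bRe B.
Proof.
apply: bopE => f g.
have -> : badj (bRe B) f g = (2^-1 * (B g f + (B f g)^*))^* by [].
have -> : bRe B f g = 2^-1 * (B f g + (B g f)^*) by [].
by rewrite rmorphM rmorphD /= conjCK fmorphV /= conjC_nat addrC.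
Qed.

Lemma channel_scale (K : cop Adot) c : K c = c *: K 1.
Proof.
apply: HminusE => f; have := cadjP K f c; rewrite HminusZ /cadj /pairing.
by move=> /(congr1 Num.conj); rewrite rmorphM /= !conjCK mulrC.
Qed.

Lemma von_neumann_U_bext11 : von_neumann_U gp gm (bext 1 1) (- 1).
Proof.
have domE k : domain (bext 1 1) (hval gp + k *: hval gm) <-> -1 = k.
  rewrite -[hval gp + _]/(hval (gp + k *: gm)) boundary_extension_domain.
  rewrite !dotpDl !dotpZl al_gp be_gp al_gm be_gm mulr0 addr0 add0r !mulr1 !mul1r.
  by split=> [h|<-]; [rewrite -[LHS]addr0 -h addKr|rewrite subrr].
by split=> [|k [_ /domE]//]; split; [rewrite normrN1|apply/domE].
Qed.

(** * State-space, channel and main operators for the parameter a *)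

Section Theta1a.
Variables (phi psi : Hminus Adot) (a : C).
Hypotheses (phiE : forall f, pairing f phi = al f)
  (psiE : forall f, pairing f psi = be f) (a0 : 0 < a) (a1 : a < 1).

Let aR : a^* = a. Proof. by apply: conj_Creal; rewrite gtr0_real. Qed.

Let aBR : (1 - a)^* = 1 - a. Proof. by rewrite rmorphB rmorph1 /= aR. Qed.
Let aDR : (1 + a)^* = 1 + a. Proof. by rewrite rmorphD rmorph1 /= aR. Qed.

Let phi_conj f : phi f = (al f)^*.
Proof. by rewrite -phiE /pairing conjCK. Qed.

Let psi_conj f : psi f = (be f)^*.
Proof. by rewrite -psiE /pairing conjCK. Qed.

Local Notation w := (- ('i / 2) *: (phi - psi)).

Lemma phi_psi_annihilates f : graph Adot (hval f, astar f) -> (phi - psi) f = 0.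
Proof.
move=> Af; rewrite HminusD HminusN phi_conj psi_conj.
by rewrite (al_domain Af) (be_domain Af) subrr.
Qed.

Lemma phi_psi_neq0 : phi - psi != 0.
Proof.
apply/eqP => /(congr1 (fun u : Hminus Adot => u gp)).
rewrite HminusD HminusN phi_conj psi_conj al_gp be_gp.
by rewrite rmorph1 rmorph0 subr0 => /eqP; rewrite oner_eq0.
Qed.

Lemma w_neq0 : w != 0.
Proof.
rewrite scaler_eq0 negb_or phi_psi_neq0 oppr_eq0 mulf_neq0 ?neq0Ci //.
by rewrite invr_neq0 ?pnatr_eq0.
Qed.

Lemma w_annihilates f : graph Adot (hval f, astar f) -> w f = 0.
Proof. by move=> Af; rewrite HminusZ phi_psi_annihilates // mulr0. Qed.

Lemma wE g : w g = - ('i / 2) * ((al g)^* - (be g)^*).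
Proof. by rewrite HminusZ HminusD HminusN phi_conj psi_conj. Qed.

Lemma state_1aE f : state_1a a phi psi f =
  embed Adot (astar f) + ((1 - a) * al f + (1 + a) * be f) *: w.
Proof.
have -> : state_1a a phi psi f = embed Adot (astar f) -
  ('i / 2) *: (pairing f ((1 - a) *: phi + (1 + a) *: psi) *: (phi - psi)) by [].
rewrite /pairing HminusD !HminusZ phi_conj psi_conj rmorphD !rmorphM /= !conjCK.
rewrite aBR aDR; congr (_ + _).
by rewrite [RHS]scalerA mulrN scaleNr scalerA mulrC.
Qed.

(** Moving Adot^* across the pairing leaves the boundary term of Green's formula; combined with the
    adjoint of the rank-one term it swaps 1 - a and 1 + a. *)
Lemma badj_state_1aE f : badj (state_1a a phi psi) f =
  embed Adot (astar f) + ((1 + a) * al f + (1 - a) * be f) *: w.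
Proof.
apply: HminusE => g.
have -> : badj (state_1a a phi psi) f g = (state_1a a phi psi g f)^* by [].
rewrite state_1aE !HminusD !(HminusZ _ w) !wE.
have -> : embed Adot (astar g) f = dot (astar g) (hval f) by [].
have -> : embed Adot (astar f) g = dot (astar f) (hval g) by [].
have := green_formula f g; rewrite /green => /(canRL (subrK _)) ->.
rewrite rmorphD /= -dotC; move: (al f) (be f) (al g) (be g) => x y x' y'.
rewrite rmorphM rmorphD !rmorphM /= aBR aDR !rmorphN !rmorphM rmorphB /=.
rewrite !conjCK fmorphV /= conjCi conjC_nat.
by field.
Qed.

Lemma bRe_state_1aE f : bRe (state_1a a phi psi) f =
  embed Adot (astar f) + (1 * al f + 1 * be f) *: w.
Proof.
rewrite /bRe bopZ bopD state_1aE badj_state_1aE addrACA -scalerDl -mulr2n.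
rewrite scalerDr -[embed _ _ *+ 2]scaler_nat scalerA mulVf ?pnatr_eq0 // scale1r.
by congr (_ + _); rewrite [LHS]scalerA; congr (_ *: _); field.
Qed.

Lemma bIm_state_1aE f : bIm (state_1a a phi psi) f =
  (a / 2 * (al f - be f)) *: (phi - psi).
Proof.
rewrite /bIm bopZ bopD bopN state_1aE badj_state_1aE opprD addrACA subrr add0r.
rewrite -scalerBl !scalerA; congr (_ *: _).
by field; exact: neq0Ci.
Qed.

Lemma quasi_kernel_state_1a :
  quasi_kernel (state_1a a phi psi) = bext (1 - a) (1 + a).
Proof. exact: (quasi_kernel_boundary w_neq0 w_annihilates state_1aE). Qed.

Lemma quasi_kernel_badj_state_1a :
  quasi_kernel (badj (state_1a a phi psi)) = bext (1 + a) (1 - a).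
Proof. exact: (quasi_kernel_boundary w_neq0 w_annihilates badj_state_1aE). Qed.

Lemma quasi_kernel_bRe_state_1a :
  quasi_kernel (bRe (state_1a a phi psi)) = bext 1 1.
Proof. exact: (quasi_kernel_boundary w_neq0 w_annihilates bRe_state_1aE). Qed.

Local Notation K1 := (vector_cop (chi_1a a phi psi)).
Local Notation s := (sqrtC (a / 2)).

Let sR : s^* = s.
Proof. by apply: conj_Creal; rewrite ger0_real // sqrtC_ge0 divr_ge0 // ltW. Qed.

Lemma cadj_1aE f : cadj K1 f = s * (al f - be f).
Proof.
have -> : cadj K1 f = ((1 *: (s *: (phi - psi)) : Hminus Adot) f)^* by [].
rewrite scale1r HminusZ HminusD HminusN phi_conj psi_conj.
by rewrite rmorphM rmorphB /= sR !conjCK.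
Qed.

Lemma bIm_channel_1a f : bIm (state_1a a phi psi) f = K1 (cadj K1 f).
Proof.
have -> : K1 (cadj K1 f) = cadj K1 f *: (s *: (phi - psi)) by [].
rewrite bIm_state_1aE cadj_1aE scalerA; congr (_ *: _).
by rewrite [RHS]mulrAC -expr2 sqrtCK.
Qed.

(** The part in H gives the eigenvalue equation; comparing coefficients of phi - psi gives -(i/2)(al
    f + be f) = s. *)
Lemma resolvent_channel_1a T z f :
  resolvent_channel (Array (state_1a a phi psi) K1 T) z f <->
  astar f = z *: hval f /\ al f + be f = 2 * 'i * s.
Proof.
have -> : resolvent_channel (Array (state_1a a phi psi) K1 T) z f =
  (bRe (state_1a a phi psi) f - z *: embed Adot (hval f) =
    1 *: (s *: (phi - psi)) :> Hminus Adot) by [].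
rewrite bRe_state_1aE scale1r !mul1r -embed_linearZ addrAC -embed_linearB.
split=> [e|[-> e]]; last first.
  have -> : z *: hval f - z *: hval f = 0 by rewrite subrr.
  rewrite -(scale0r (0 : H)) embed_linearZ scale0r add0r scalerA e.
  congr (_ *: _); transitivity (- 'i ^+ 2 * s); first by field.
  by rewrite sqrCi opprK mul1r.
have : embed Adot (astar f - z *: hval f) =
    (s + 'i / 2 * (al f + be f)) *: (phi - psi).
  rewrite scalerDl -e -addrA scalerA mulrN scaleNr [_ * ('i / 2)]mulrC.
  by rewrite addNr addr0.
move=> /(embed_eq_annihilator phi_psi_neq0 phi_psi_annihilates)[c0 /eqP].
rewrite subr_eq0 => /eqP ->; split=> //.
have : 2 * 'i * (s + 'i / 2 * (al f + be f)) = 0 by rewrite c0 mulr0.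
have -> : 2 * 'i * (s + 'i / 2 * (al f + be f)) =
  2 * 'i * s + 'i ^+ 2 * (al f + be f) by field.
by rewrite sqrCi mulN1r => /eqP; rewrite subr_eq0 => /eqP ->.
Qed.

Local Notation T1a := (bext (1 - a) (1 + a)).

Let a1_gt0 : 0 < 1 + a. Proof. by rewrite addr_gt0. Qed.
Let a1_neq0 : 1 + a != 0. Proof. exact: lt0r_neq0. Qed.

Let al_kappa k : al (gp - k *: gm) = 1.
Proof. by rewrite dotpDl dotpNl dotpZl al_gp al_gm mulr0 subr0. Qed.

Let be_kappa k : be (gp - k *: gm) = - k.
Proof. by rewrite dotpDl dotpNl dotpZl be_gp be_gm mulr1 sub0r. Qed.

(** The boundary values of g+ - k g- are (1, -k), and the boundary condition on them is solved by a
    single k. *)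
Lemma von_neumann_kappa_1a : von_neumann_kappa gp gm T1a ((1 - a) / (1 + a)).
Proof.
have domE k : domain T1a (hval gp - k *: hval gm) <-> 1 - a = (1 + a) * k.
  rewrite -[hval gp - _]/(hval (gp - k *: gm)) boundary_extension_domain.
  rewrite al_kappa be_kappa.
  by rewrite mulr1 mulrN; split=> [/subr0_eq|->]; rewrite ?subrr.
split=> [|k [_ /domE ->]]; last by rewrite mulrC mulKf.
split; last by apply/domE; rewrite mulrC divfK.
rewrite normrM normfV gtr0_norm ?subr_gt0 // gtr0_norm // ltr_pdivrMr // mul1r.
by rewrite ltrD2l (lt_trans _ a0) // oppr_lt0.
Qed.

(** On g+ - kappa g- Green's form is i (1 - kappa^2), and (1 + a)^2 (1 - kappa^2) = 4a. *)
Lemma T1a_not_symmetric : ~ symmetric_op T1a.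
Proof.
pose g : Hplus Adot := gp - ((1 - a) / (1 + a)) *: gm.
have Tg : T1a (hval g, astar g).
  by apply/boundary_extensionP; rewrite al_kappa be_kappa mulrN mulr1 mulrC divfK ?subrr.
move=> sT; have /= := sT _ Tg _ Tg => /eqP.
rewrite -subr_eq0 -/(green g g) green_formula al_kappa be_kappa mulf_eq0.
rewrite (negPf (neq0Ci C)).
rewrite /= rmorphN mulrNN rmorph1 mulr1 rmorphM fmorphV /= aBR aDR => /eqP e.
have : (1 + a) ^+ 2 * (1 - (1 - a) / (1 + a) * ((1 - a) / (1 + a))) = 4 * a by field.
rewrite e mulr0 => /esym/eqP; rewrite mulf_eq0 pnatr_eq0 /=.
by rewrite (gt_eqF a0).
Qed.

(** By Green's formula Im (Tf, f) = (|al f|^2 - |be f|^2) / 2, while the boundary condition makes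
    |be f| at most |al f|. *)
Lemma T1a_dissipative : dissipative T1a.
Proof.
move=> f0 h [f [/= <- <- fT]]; rewrite ImE.
have -> : 'i * ((dot (astar f) (hval f))^* - dot (astar f) (hval f)) / 2 =
    (- 'i / 2) * green f f by rewrite /green -dotC; ring.
rewrite green_formula mulrA (_ : - 'i / 2 * 'i = - 'i ^+ 2 / 2); last by ring.
rewrite sqrCi opprK mulr_ge0 ?divr_ge0 // -!normCK subr_ge0.
rewrite ler_pXn2r ?nnegrE // -(ler_pM2l a1_gt0).
have -> : (1 + a) * `|be f| = (1 - a) * `|al f|.
  rewrite -{1}(gtr0_norm a1_gt0) -normrM -[X in X * `|al f|]gtr0_norm ?subr_gt0 //.
  by rewrite -normrM -normrN -sub0r -fT addrK.
by rewrite ler_wpM2r // lerD2l (le_trans _ (ltW a0)) // oppr_le0 ltW.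
Qed.

(** For uniqueness of the L-system: the state-space operator determines the main operator. *)
Lemma main_1aE T : is_operator T -> ~ symmetric_op T -> Adot `<=` T ->
  extends (state_1a a phi psi) T -> T = T1a.
Proof.
move=> oT nT AT; rewrite /extends quasi_kernel_state_1a.
by apply: extension_in_boundary_extension => //; rewrite a1_neq0 orbT.
Qed.

Lemma is_Lsystem_1a : deficiency_indices_11 Adot -> selfadjoint (bext 1 1) ->
  resolvent_set T1a !=set0 -> is_Lsystem (Array (state_1a a phi psi) K1 T1a).
Proof.
move=> d11 sA rT; split=> //.
- split=> //; last exact: T1a_dissipative.
  split; [exact: boundary_extension_operator|exact: T1a_not_symmetric|
    exact: symop_boundary_extension|exact: boundary_extension_adjoint].
- split.
  + rewrite /extends quasi_kernel_state_1a; split=> //.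
    exact: symop_boundary_extension.
  + split.
      rewrite /extends quasi_kernel_badj_state_1a.
      by have := @adjoint_boundary_extension (1 - a) (1 + a); rewrite aBR aDR.
    move=> x Ax q /boundary_extension_adjoint/(_ _ Ax).
    by rewrite (dotC q.2) (dotC q.1) => ->.
  + have qE := quasi_kernel_bRe_state_1a; split; last by rewrite qE.
    split; last by rewrite badj_bRe.
    by rewrite /extends qE; exact: symop_boundary_extension.
- by move=> f; have := bIm_channel_1a f.
Qed.

End Theta1a.

(* In the paper's terms: Re AA = Adot^* + (., phi + psi) w with
   w = -(i/2)(phi - psi) + r (phi + psi) and r real. *)
Lemma selfadjoint_biextensionE B :
  selfadjoint_biextension B -> quasi_kernel B = bext 1 1 ->
  exists w, [/\ forall f, B f = embed Adot (astar f) + (al f + be f) *: w,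
    forall f, w f = (al f)^* * w gp + (be f)^* * w gm,
    w gp = (w gm)^* & w gm - (w gm)^* = 'i].
Proof.
move=> [extB BB] qB; pose D f := B f - embed Adot (astar f).
have DP c f g : D (c *: f + g) = c *: D f + D g.
  rewrite /D bop_linear astar_linear embed_linear scalerBr opprD.
  by rewrite !addrA; congr (_ - _); rewrite addrAC.
have Dq f : quasi_kernel B (hval f, astar f) -> D f = 0.
  by move=> [f' /= /hval_inj -> Bf]; rewrite /D Bf subrr.
have DA f : graph Adot (hval f, astar f) -> D f = 0 by move=> /extB/Dq.
have Dpm : D (gp - gm) = 0.
  apply: Dq; rewrite qB; apply/boundary_extensionP.
  by rewrite !dotpDl !dotpNl al_gp be_gp al_gm be_gm; ring.
(* [D] kills g+ - g-, which is in Dom A, and Dom Adot, so only the term along g- survives. *)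
have fE f : f = al f *: (gp - gm) + ((al f + be f) *: gm + interior_part f).
  rewrite scalerBr (scalerDl gm (al f)) addrA [X in X + _]addrA subrK addrC.
  exact: interior_partE.
have DE f : D f = (al f + be f) *: D gm.
  rewrite {1}(fE f) DP Dpm scaler0 add0r DP (DA _ (interior_partP f)).
  by rewrite addr0.
have BE f : B f = embed Adot (astar f) + (al f + be f) *: D gm.
  by rewrite -DE addrC subrK.
move: (D gm) BE => w {DE} BE.
(* Self-adjointness of [B] expresses Green's form through [w]; testing on g- against g-, g+ and Dom
   Adot gives all that is claimed of [w]. *)
have greenE f g : green f g =
    (al g + be g)^* * (w f)^* - (al f + be f) * w g.
  have : B f g = (B g f)^* by rewrite {1}BB.
  rewrite !BE !HminusD !HminusZ !embedE [in RHS]rmorphD [in RHS]rmorphM /= -dotC.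
  by rewrite /green => /(canRL (addrK _)) ->; ring.
have wmm : w gm - (w gm)^* = 'i.
  have := greenE gm gm; rewrite green_formula al_gm be_gm add0r rmorph0 rmorph1.
  by rewrite mulr0 sub0r !mul1r mulrN mulr1 => /(canRL opprK) ->; rewrite opprB.
have wpm : w gp = (w gm)^*.
  have := greenE gm gp; rewrite green_formula al_gm be_gm al_gp be_gp add0r addr0.
  by rewrite rmorph0 rmorph1 mul0r mulr0 subrr mulr0 !mul1r => /esym/subr0_eq.
have wA f : graph Adot (hval f, astar f) -> w f = 0.
  move=> Af; have := greenE gm f; rewrite green_formula al_gm be_gm.
  rewrite (al_domain Af) (be_domain Af) !rmorph0 !mulr0 subrr mulr0 !add0r.
  by rewrite rmorph0 mul0r sub0r mul1r => /esym/eqP; rewrite oppr_eq0 => /eqP.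
exists w; split=> // f.
rewrite {1}(interior_partE f) HminusDr (wA _ (interior_partP f)) add0r.
by rewrite HminusDr !HminusZr.
Qed.

Lemma Lsystem_main_1a a (Th : array Adot) (V : C^o -> C^o) :
  a \is Num.real -> a != 0 -> is_Lsystem Th ->
  quasi_kernel (bRe (state Th)) = bext 1 1 ->
  is_impedance Th V -> V 'i = a * 'i ->
  main Th = bext (1 - a) (1 + a).
Proof.
move=> aR a0 [_ [[oT nT AT TA] _ _] [[extT _] _ [sB sqB]] ImK] qB [_ _ VE] Vi.
have [w [BE wE wpm wmm]] := selfadjoint_biextensionE sB qB.
set chi := channel Th 1.
have SE f : state Th f =
    embed Adot (astar f) + ((al f + be f) *: w + ('i * (chi f)^*) *: chi).
  by rewrite bop_ReIm ImK channel_scale BE scalerA [RHS]addrA.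
have Tker x : main Th x -> exists f, [/\ hval f = x.1, astar f = x.2 &
    (al f + be f) *: w + ('i * (chi f)^*) *: chi = 0].
  move=> Tx; have [f fx Sf] := extT _ Tx; exists f.
  have fh : astar f = x.2.
    by apply: astar_unique; rewrite fx -surjective_pairing; exact: TA.
  split=> //; have /eqP := SE f; rewrite Sf fh -subr_eq0 opprD addrA subrr add0r.
  by rewrite oppr_eq0 => /eqP.
have w0 : w != 0.
  apply/eqP => w0; move: wmm; rewrite w0 rmorph0 subrr => /esym/eqP.
  by rewrite (negPf (neq0Ci C)).
(* Some vector of the main operator lies outside the symmetric A; there al f + be f is nonzero, and
   the relation of [Tker] can be solved for [chi]. *)
have [s chiE] : exists s, chi = s *: w.
  have [x Tx nx] : exists2 x, main Th x & ~ bext 1 1 x.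
    apply: contrapT => nT'; apply: nT; have TB : main Th `<=` bext 1 1.
      by move=> x Tx; apply: contrapT => nx; apply: nT'; exists x.
    have sym11 : symmetric_op (bext 1 1).
      by rewrite -qB => x Bx; case: sqB => _ _ <-.
    by move=> x /TB/sym11 Ax q /TB; exact: Ax.
  have [f [fx fh e]] := Tker _ Tx.
  have ab0 : al f + be f != 0.
    apply: contra_notN nx => /eqP ab; exists f; split=> //.
    by rewrite !mul1r.
  have chif : 'i * (chi f)^* != 0.
    apply: contraNneq w0 => c0; move: e; rewrite c0 scale0r addr0 => /eqP.
    by rewrite scaler_eq0 (negPf ab0).
  exists (- ('i * (chi f)^*)^-1 * (al f + be f)).
  rewrite mulNr scaleNr -scalerA; move: e => /eqP; rewrite addr_eq0 => /eqP ->.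
  by rewrite scalerN opprK scalerA mulVf // scale1r.
(* The impedance at z = i, where s g+ solves the resolvent equation, already
   determines both |s|^2 and w. *)
have sV : s * s^* * w gm = a * 'i.
  rewrite -Vi (VE 'i (s *: gp)) ?Im_i ?oner_eq0 //.
    rewrite /cadj -/chi /pairing chiE HminusZ HminusZr wpm.
    by rewrite rmorphM rmorphM /= !conjCK; ring.
  rewrite /resolvent_channel -/chi BE chiE astarZ (deficiency_astar gpE).
  rewrite !dotpZl al_gp be_gp mulr0 mulr1 addr0 -embed_linearZ.
  have -> : 'i *: hval (s *: gp) = s *: ('i *: hval gp) by rewrite /= !scalerA mulrC.
  by rewrite addrAC subrr add0r.
have ss : s * s^* = 2 * a.
  have : s * s^* * (w gm - (w gm)^*) = 2 * a * 'i.
    rewrite mulrBr sV.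
    have -> : s * s^* * (w gm)^* = (s * s^* * w gm)^*.
      by rewrite rmorphM rmorphM /= conjCK [s^* * s]mulrC.
    by rewrite sV rmorphM /= (conj_Creal aR) conjCi; ring.
  by rewrite wmm => /mulIf -> //; exact: neq0Ci.
have wgm : w gm = 'i / 2.
  have a20 : 2 * a != 0 by rewrite mulf_neq0 ?pnatr_eq0.
  by apply: (mulfI a20); rewrite -{1}ss sV; field.
apply: extension_in_boundary_extension => //.
  rewrite -negb_and; apply: contraNN a0 => /andP[/eqP h1 /eqP h2].
  have : (1 + a) - (1 - a) = 2 * a by ring.
  by rewrite h1 h2 subrr => /esym/eqP; rewrite mulf_eq0 pnatr_eq0.
move=> x /Tker[f [fx fh e]]; exists f; split=> //.
move: e; rewrite chiE HminusZ wE wpm wgm scalerA -scalerDl => /eqP.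
rewrite scaler_eq0 (negPf w0) orbF => /eqP e.
move: (al f) (be f) e => y z e; rewrite -[RHS]e.
have ci : ('i / 2)^* = - ('i / 2) :> C.
  by rewrite rmorphM fmorphV /= conjCi conjC_nat mulNr.
have -> : (s * (y^* * ('i / 2)^* + z^* * ('i / 2)))^* = s^* * ('i / 2 * (y - z)).
  by rewrite rmorphM rmorphD !rmorphM /= !conjCK -!rmorphM /= ci; ring.
(* With i^2 = -1 and |s|^2 = 2a the last term is -a (y - z). *)
transitivity (y + z + 'i ^+ 2 / 2 * (s * s^*) * (y - z)); last by ring.
by rewrite sqrCi ss; field.
Qed.

End BoundaryValues.

(** * Impedance function *)

Section ImpedanceFunction.
Context {R : realType} {H : hilbertType R[i]} {Adot : symop H}.
Variables gp gm : Hplus Adot.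
Hypotheses (d11 : deficiency_indices_11 Adot)
  (gpE : deficiency_space Adot 'i (hval gp)) (gp1 : normp gp = 1)
  (gmE : deficiency_space Adot (- 'i) (hval gm)) (gm1 : normp gm = 1).
Local Notation al f := (dotp f gp).
Local Notation be f := (dotp f gm).
Local Notation bext := (boundary_extension gp gm).
Hypothesis sA : selfadjoint (bext 1 1).

Let dec := von_neumann_formula d11 gpE gp1 gmE gm1.

Let Im_Ni : 'Im (- 'i : R[i]) != 0.
Proof. by rewrite raddfN /= Im_i oppr_eq0 oner_eq0. Qed.

Lemma resolvent_Hplus z h : 'Im z != 0 -> exists r : Hplus Adot,
  [/\ hval r = resolvent (bext 1 1) z h, astar r = h + z *: hval r,
      al r = (1 - 'i * z) * dot (hval r) (hval gp) - 'i * dot h (hval gp)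
    & be r = - al r].
Proof.
move=> z0; have [r [/= rE rA r11]] := resolventP sA h z0.
exists r; split=> //; first by rewrite rA rE.
  rewrite /dotp rA -rE (deficiency_astar gpE) dotZr dotDl dotZl conjCi.
  by ring.
by move/eqP: r11; rewrite !mul1r addrC addr_eq0 => /eqP.
Qed.

(** With f = (A - z)^-1 g one has A f = g + z f, so z A f + f = z g + (z^2 + 1) f. *)
Lemma weyl_titchmarshE z g : 'Im z != 0 -> weyl_titchmarsh (bext 1 1) g z =
  z * `|g| ^+ 2 + (z ^+ 2 + 1) * dot (resolvent (bext 1 1) z g) g.
Proof.
move=> z0; rewrite /weyl_titchmarsh -/(resolvent (bext 1 1) z g).
have rA := resolventP sA g z0; have [oA _ _] := sA.
rewrite (value_unique oA rA).
by rewrite !dotE dotxx; ring.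
Qed.

Section Theta1a.
Variables (phi psi : Hminus Adot) (a : R[i]).
Hypotheses (phiE : forall f, pairing f phi = al f)
  (psiE : forall f, pairing f psi = be f) (a0 : 0 < a) (a1 : a < 1).
Local Notation T1a := (bext (1 - a) (1 + a)).

Let a1_neq0 : 1 + a != 0. Proof. by rewrite lt0r_neq0 // addr_gt0. Qed.

(* (T1a + i)^-1 differs from (A + i)^-1 by a multiple of g-, which spans
   Ker(Adot^* + i); the coefficient enforces the boundary condition of T1a. *)
Let res h := resolvent (bext 1 1) (- 'i) h +
  (- (2 * a * 'i / (1 + a)) * dot h (hval gp)) *: hval gm.

Let res_linear : linear res.
Proof.
move=> c h k; rewrite /res (resolvent_linear sA) // dotDl dotZl.
move: (- (2 * a * 'i / (1 + a))) => b.
rewrite mulrDr scalerDl [b * (c * _)]mulrCA -[(c * _) *: _]scalerA scalerDr.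
by rewrite !addrA; congr (_ + _); rewrite addrAC.
Qed.

Let res_continuous : continuous res.
Proof.
pose b := - (2 * a * 'i / (1 + a)) : R[i].
pose K := 1 / `|'Im (- 'i : R[i])| + `|b| * `|hval gp| * `|hval gm|.
have K0 : 0 <= K by rewrite addr_ge0 // ?divr_ge0 // !mulr_ge0.
have K1 : 0 < K + 1 by rewrite ltr_wpDl.
move=> x; apply/cvgrPdist_lt => e e0; near=> y.
have : `|x - y| < e / (K + 1).
  by near: y; apply: cvgr_dist_lt => //; rewrite divr_gt0.
rewrite ltr_pdivlMr // => /(le_lt_trans _); apply.
have -> : res x - res y = res (x - y).
  by have := res_linear (-1) y x; rewrite !scaleN1r ![- _ + _]addrC.
rewrite (@le_trans _ _ (`|x - y| * K)) //; last by rewrite ler_wpM2l // lerDl.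
rewrite (le_trans (ler_normD _ _)) // mulrDr lerD //.
  by rewrite div1r (resolvent_bound sA).
rewrite normrZ normrM -/b mulrA ler_wpM2r // mulrCA ler_wpM2l //.
exact: dot_cauchy_schwarz.
Unshelve. all: by end_near. Qed.

(** The point -i works: [res] provides solutions, and dissipativity excludes the eigenvalue -i,
    which gives uniqueness. *)
Lemma resolvent_set_T1a : resolvent_set T1a !=set0.
Proof.
exists (- 'i); pose L : {linear H -> H} :=
  HB.pack res (GRing.isLinear.Build _ _ _ _ res res_linear).
exists L; split; first exact: res_continuous.
have resP h : T1a (res h, h + (- 'i) *: res h).
  have [r [rE rA alr ber]] := resolvent_Hplus h Im_Ni.
  pose d := - (2 * a * 'i / (1 + a)) * dot h (hval gp).
  exists (r + d *: gm); split.
  - by rewrite /= rE.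
  - rewrite astarD astarZ rA (deficiency_astar gmE) /= /res -rE -/d.
    by rewrite scalerDr !scalerA (mulrC d) addrA.
  - rewrite !dotpDl !dotpZl ber alr (al_gm gpE gmE) (be_gm gm1) /d.
    (* At z = -i the term (r, g+) drops out: al r = -i (h, g+) and be r = i (h, g+), which fixes the
       coefficient of g- in [res]. *)
    have -> : 1 - 'i * - 'i = 0 :> R[i].
      by rewrite mulrN opprK -expr2 sqrCi subrr.
    by rewrite mul0r; field.
move=> h f; split=> [Tf|->]; last exact: resP.
have oT := boundary_extension_operator gpE gmE (1 - a) (1 + a).
have := operatorB oT Tf (resP h).
rewrite -[L h]/(res h); move: (res h) => k.
rewrite [- (h + _)]opprD addrACA subrr add0r -scalerBr.
move=> /(T1a_dissipative gpE gp1 gmE gm1 dec a0 a1).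
rewrite dotZl dotxx mulNr raddfN /= ImMil.
rewrite (Creal_ReP _ _) ?rpredX ?normr_real // oppr_ge0 => e0.
have : `|f - k| ^+ 2 == 0 by rewrite eq_le e0 exprn_ge0.
by rewrite expf_eq0 normr_eq0 subr_eq0 => /eqP.
Qed.

Lemma impedance_1a (g : H) (V : R[i]^o -> R[i]^o) T :
  deficiency_space Adot 'i g -> `|g| = 1 ->
  V = (fun z => a * (z + (z ^+ 2 + 1) * dot (resolvent (bext 1 1) z g) g)) ->
  is_impedance (Array (state_1a a phi psi) (vector_cop (chi_1a a phi psi)) T) V.
Proof.
move=> gE g1 VE.
have rcP := resolvent_channel_1a gpE gp1 gmE gm1 dec phiE psiE a0.
have [c gc] := one_dimensional_span d11.1 gpE (deficiency_neq0 gpE gp1) gE.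
(* The norms differ: |g|^2 = 1 but |g+|^2 = 1/2. *)
have cc : c * c^* = 2.
  have : dot g g = 1 by rewrite dotxx g1 expr1n.
  rewrite gc dotZl dotZr (dot_gp gpE gp1) mulrA.
  by move=> /(canRL (divfK _)) ->; rewrite ?mul1r ?pnatr_eq0.
have gres z : 'Im z != 0 -> dot (resolvent (bext 1 1) z g) g =
    2 * dot (resolvent (bext 1 1) z (hval gp)) (hval gp).
  move=> z0; have := resolvent_linear sA z0 c (hval gp) 0.
  have -> : resolvent (bext 1 1) z 0 = 0.
    by have := resolvent_linear sA z0 (-1) 0 0; rewrite scaler0 addr0 scaleN1r addNr.
  by rewrite !addr0 gc => ->; rewrite dotZl dotZr mulrA cc.
(* The difference of two solutions has al + be = 0, hence lies in Dom A, and A has no nonreal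
   eigenvalue. *)
have uniq z f f' : 'Im z != 0 -> astar f = z *: hval f ->
    astar f' = z *: hval f' -> al f + be f = al f' + be f' -> f = f'.
  move=> z0 fA f'A ff'; apply: hval_inj; apply/eqP; rewrite -subr_eq0.
  apply/eqP; apply: (symmetric_eigen0 (selfadjoint_symmetric sA) z0).
  exists (f - f'); split=> //; first by rewrite astarD astarN fA f'A /= scalerBr.
  by rewrite !mul1r !dotpDl !dotpNl addrACA -opprD ff' subrr.
have sol z : 'Im z != 0 -> exists f,
  [/\ astar f = z *: hval f, al f + be f = 2 * 'i * sqrtC (a / 2)
    & V z = sqrtC (a / 2) * (al f - be f)].
  move=> z0; have [r [rE rA alr ber]] := resolvent_Hplus (hval gp) z0.
  set s := sqrtC (a / 2).
  have ss : s ^+ 2 = a / 2 by rewrite sqrtCK.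
  (* g+ + (z - i) (A - z)^-1 g+ spans Ker(Adot^* - z). *)
  exists ((2 * 'i * s) *: (gp + (z - 'i) *: r)); split.
  - rewrite astarZ astarD astarZ rA (deficiency_astar gpE) /=.
    rewrite !scalerDr !scalerA.
    by rewrite addrA -scalerDl; congr (_ *: _ + _ *: _); ring.
  (* On g+ the sum al + be is 1 and on [r] it is 0, whence the scalar 2 i s. *)
  - by rewrite !dotpZl !dotpDl !dotpZl ber (al_gp gp1) (be_gp gpE gmE); ring.
  - rewrite !dotpZl !dotpDl !dotpZl ber (al_gp gp1) (be_gp gpE gmE) alr.
    rewrite (dot_gp gpE gp1) VE gres // -rE; move: (dot _ _) => y.
    have := sqrCi R[i]; move: 'i => j jj.
    (* The two sides differ by a multiple of i^2 + 1. *)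
    transitivity (2 * s ^+ 2 * (z + 2 * (z ^+ 2 + 1) * y
        + (j ^+ 2 + 1) * (j - z + 2 * y * (j * z - z ^+ 2 - 1)))); last by field.
    by rewrite jj addNr mul0r addr0 ss; field.
split.
- move=> z z0; rewrite VE.
  have F := resolvent_derivable (g := g) (k := g) sA z0.
  apply: (@derivableM _ _ (fun=> a)); first exact: derivable_cst.
  apply: (@derivableD _ _ _ id); first exact: derivable_id.
  apply: (derivableM _ F).
  apply: (@derivableD R[i] R[i]^o R[i]^o (fun z : R[i] => z ^+ 2) (cst 1)).
    exact: (@exprn_derivable R[i] 2 z 1).
  exact: derivable_cst.
- move=> z z0 _; have [f [fA fab _]] := sol z z0; exists f.
  split; first exact/rcP.
  by move=> f' /rcP[f'A f'ab]; apply: (uniq z) => //; rewrite fab.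
- move=> z f z0 /rcP[fA fab]; have [f' [f'A f'ab ->]] := sol z z0.
  rewrite (uniq z f f' z0 fA f'A) ?fab //.
  by rewrite (cadj_1aE phiE psiE a0).
Qed.

End Theta1a.
End ImpedanceFunction.

(** * Existence, uniqueness and von Neumann parameters *)

Local Open Scope complex_scope.

Theorem theorem7 (R : realType) (H : hilbertType R[i]) (Adot : symop H)
    (gp gm : Hplus Adot) (phi psi : Hminus Adot) (A : set (H * H)) (g : H)
    (a : R) :
  deficiency_indices_11 Adot ->
  deficiency_space Adot 'i%R (hval gp) -> normp gp = 1 ->
  deficiency_space Adot (- 'i%R) (hval gm) -> normp gm = 1 ->
  riesz_berezansky phi = gp -> riesz_berezansky psi = gm ->
  selfadjoint A -> Adot `<=` A -> domain A (hval gp - hval gm) ->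
  deficiency_space Adot 'i%R g -> `|g| = 1 ->
  0 < a < 1 ->
  let aM (z : R[i]) := a%:C * weyl_titchmarsh A g z in
  let is_Theta_1a (Theta : array Adot) :=
    [/\ is_Lsystem Theta,
        state Theta = state_1a a%:C phi psi,
        channel Theta = vector_cop (chi_1a a%:C phi psi)
      & impedance_coincides Theta aM] in
  [/\ exists! Theta, is_Theta_1a Theta,
      forall Theta, is_Theta_1a Theta ->
        [/\ von_neumann_kappa gp gm (main Theta) ((1 - a) / (1 + a))%:C,
            quasi_kernel (bRe (state Theta)) = A
          & von_neumann_U gp gm (quasi_kernel (bRe (state Theta))) (- 1)]
    & forall Theta : array Adot,
        is_Lsystem Theta ->
        quasi_kernel (bRe (state Theta)) = A ->
        impedance_coincides Theta aM ->
        von_neumann_kappa gp gm (main Theta) ((1 - a) / (1 + a))%:C /\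
        von_neumann_U gp gm (quasi_kernel (bRe (state Theta))) (- 1)].
Proof.
move=> d11 gpE gp1 gmE gm1 phiR psiR sA AA Apm gE g1 /andP[a0 a1] aM isTh.
have a0C : 0 < a%:C by rewrite ltcR.
have a1C : a%:C < 1 by rewrite ltcR.
have dec := von_neumann_formula d11 gpE gp1 gmE gm1.
have phiE : forall f, pairing f phi = dotp f gp.
  apply: riesz_berezansky_pairing phiR; apply: contraNneq (deficiency_neq0 gpE gp1).
  by move=> ->.
have psiE : forall f, pairing f psi = dotp f gm.
  apply: riesz_berezansky_pairing psiR; apply: contraNneq (deficiency_neq0 gmE gm1).
  by move=> ->.
have AE := selfadjoint_boundary_extension gpE gp1 gmE gm1 dec sA AA Apm.
have sA11 : selfadjoint (boundary_extension gp gm 1 1) by rewrite -AE.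
have aME z : 'Im z != 0 -> aM z = a%:C *
    (z + (z ^+ 2 + 1) * dot (resolvent (boundary_extension gp gm 1 1) z g) g).
  by move=> z0; rewrite /aM AE (weyl_titchmarshE sA11) // g1 expr1n mulr1.
pose T1a := boundary_extension gp gm (1 - a%:C) (1 + a%:C).
have kappaE : ((1 - a) / (1 + a))%:C = (1 - a%:C) / (1 + a%:C).
  by rewrite rmorphM fmorphV rmorphB rmorphD rmorph1.
have kappa : von_neumann_kappa gp gm T1a ((1 - a) / (1 + a))%:C.
  by rewrite kappaE; exact: von_neumann_kappa_1a.
have UA : von_neumann_U gp gm A (- 1).
  by rewrite AE; exact: von_neumann_U_bext11.
have mainE Th : isTh Th -> main Th = T1a.
  case=> [[_ [[oT nT AT _] _ _] [[extT _] _ _] _] sE _ _].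
  by rewrite sE in extT; exact: (main_1aE gpE gp1 gmE dec phiE psiE a0C oT nT AT extT).
have qkE : quasi_kernel (bRe (state_1a a%:C phi psi)) = A.
  by rewrite AE; exact: quasi_kernel_bRe_state_1a.
split.
- exists (Array (state_1a a%:C phi psi) (vector_cop (chi_1a a%:C phi psi)) T1a).
  split; last first.
    move=> Th ThE; have := mainE Th ThE; case: ThE => _.
    by case: Th => ? ? ? /= -> -> _ ->.
  split=> //.
    apply: is_Lsystem_1a => //; exact: resolvent_set_T1a.
  eexists.
    exact: (impedance_1a d11 gpE gp1 gmE gm1 sA11 phiE psiE a0C _ gE g1 erefl).
  by move=> z z0; rewrite aME // gt_eqF.
- move=> Th ThE; rewrite (mainE Th ThE); case: ThE => _ -> _ _.
  by rewrite qkE.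
- move=> Th LTh qTh [V VTh VE]; rewrite qTh; split=> //.
  suff -> : main Th = T1a by [].
  apply: (Lsystem_main_1a gpE gp1 gmE gm1 dec _ _ LTh _ VTh).
  + by rewrite realE ltW.
  + by rewrite gt_eqF.
  + by rewrite qTh.
  (* At z = i the factor z^2 + 1 vanishes, so a M(i) = a i. *)
  + rewrite VE ?Im_i ?ltr01 // aME ?Im_i ?oner_eq0 //.
    by rewrite sqrCi addNr mul0r addr0.
Qed.
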